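(* Let $\mathsf{H}$ be a right quaternionic Hilbert space, let $p\in(0,\frac12)$, and let $T\in\mathfrak{B}(\mathsf{H})$ be a $p$-hyponormal operator with polar decomposition $T=U|T|$. Then the quaternionic Aluthge transform $\tilde T=|T|^{\frac12}U|T|^{\frac12}$ is $(p+\frac12)$-hyponormal.
   Context: $\mathbb{H}$ is the skew field of quaternions. A right quaternionic Hilbert space $\mathsf{H}$ is a right vector space over $\mathbb{H}$ with an inner product $\langle\cdot,\cdot\rangle:\mathsf{H}\times\mathsf{H}\to\mathbb{H}$ satisfying $\overline{\langle u,v\rangle}=\langle v,u\rangle$, $\langle u,u\rangle>0$ for $u\neq 0$, and $\langle u,vp+wq\rangle=\langle u,v\rangle p+\langle u,w\rangle q$ for $u,v,w\in\mathsf{H}$, $p,q\in\mathbb{H}$, complete in the norm $\|u\|=\sqrt{\langle u,u\rangle}$. $\mathfrak{B}(\mathsf{H})$ is the set of bounded right linear operators $T:\mathsf{H}\to\mathsf{H}$, i.e. $T(up+v)=(Tu)p+Tv$. Adjoint and selfadjoint are defined as in the complex case. $T\ge 0$ (positive) means $\langle Tx,x\rangle\geq 0$ for all $x\in\mathsf{H}$ (positive operators are selfadjoint), and $S\leq T$ means $T-S\geq 0$. The spherical spectrum $\sigma_S(T)$ is the set of $q\in\mathbb{H}$ for which $\Delta_q(T):=T^2-T(q+\bar q)+I|q|^2$ has no inverse in $\mathfrak{B}(\mathsf{H})$; for $T\ge0$ it is contained in $[0,+\infty)$. For $T\geq 0$ and $t>0$, $T^t$ is $f(T)$ with $f(s)=s^t$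 on $\sigma_S(T)$, in the quaternionic continuous functional calculus $\mathcal{C}(\sigma_S(T),\mathbb{R})\to\mathfrak{B}(\mathsf{H})$ (the continuous unital homomorphism of real Banach algebras sending the identity function to $T$; its values are selfadjoint and it is positivity preserving). Polar decomposition: $T=U|T|$ with $|T|=(T^*T)^{1/2}$ and $U\in\mathfrak{B}(\mathsf{H})$ the unique operator with $T=U|T|$, $\|Uu\|=\|u\|$ for all $u\in(\ker|T|)^\perp$, and $Uu=0$ for $u\in\ker|T|=\ker T$. For $0<s\leq 1$, $T$ is $s$-hyponormal if $(T^*T)^s\geq(TT^* )^s$. *)

(* Defs.v *)
From HB Require Import structures.
From mathcomp Require Import all_boot all_order all_algebra.
From mathcomp Require Import all_classical all_reals all_analysis.
From mathcomp Require Import ring.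

Set Implicit Arguments.
Unset Strict Implicit.
Unset Printing Implicit Defensive.

Import Order.TTheory GRing.Theory Num.Theory.
Import numFieldNormedType.Exports.
Local Open Scope classical_set_scope.
Local Open Scope ring_scope.

Reserved Notation "x %:q" (format "x %:q").
Reserved Notation "u ** q" (at level 40, left associativity).

(* Quat a b c d is a + b i + c j + d k. *)
Record quat (R : Type) := Quat { qre : R; qi : R; qj : R; qk : R }.

Section QuatRing.
Variable R : realType.
Implicit Types p q r : quat R.

Definition quat_to_tuple q := (qre q, qi q, qj q, qk q).
Definition quat_of_tuple (t : R * R * R * R) :=
  let: (a, b, c, d) := t in Quat a b c d.
Lemma quat_to_tupleK : cancel quat_to_tuple quat_of_tuple.
Proof. by case. Qed.

HB.instance Definition _ := Choice.copy (quat R) (can_type quat_to_tupleK).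

Definition qadd p q :=
  Quat (qre p + qre q) (qi p + qi q) (qj p + qj q) (qk p + qk q).
Definition qopp q := Quat (- qre q) (- qi q) (- qj q) (- qk q).
Definition qmul p q :=
  let: Quat a b c d := p in let: Quat a' b' c' d' := q in
  Quat (a * a' - b * b' - c * c' - d * d')
       (a * b' + b * a' + c * d' - d * c')
       (a * c' - b * d' + c * a' + d * b')
       (a * d' + b * c' - c * b' + d * a').

Lemma qaddA : associative qadd.
Proof. by move=> [? ? ? ?] [? ? ? ?] [? ? ? ?]; rewrite /qadd /= !addrA. Qed.
Lemma qaddC : commutative qadd.
Proof. by move=> [? ? ? ?] [? ? ? ?]; congr Quat; rewrite /= addrC. Qed.
Lemma qadd0 : left_id (Quat 0 0 0 0) qadd.
Proof. by move=> [? ? ? ?]; rewrite /qadd /= !add0r. Qed.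
Lemma qaddN : left_inverse (Quat 0 0 0 0) qopp qadd.
Proof. by move=> [? ? ? ?]; rewrite /qadd /= !addNr. Qed.

HB.instance Definition _ :=
  GRing.isZmodule.Build (quat R) qaddA qaddC qadd0 qaddN.

Lemma qmulA : associative qmul.
Proof. by move=> [? ? ? ?] [? ? ? ?] [? ? ? ?]; congr Quat; ring. Qed.
Lemma qmul1l : left_id (Quat 1 0 0 0) qmul.
Proof. by move=> [? ? ? ?]; congr Quat; ring. Qed.
Lemma qmul1r : right_id (Quat 1 0 0 0) qmul.
Proof. by move=> [? ? ? ?]; congr Quat; ring. Qed.
Lemma qmulDl : left_distributive qmul +%R.
Proof. by move=> [? ? ? ?] [? ? ? ?] [? ? ? ?]; congr Quat => /=; ring. Qed.
Lemma qmulDr : right_distributive qmul +%R.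
Proof. by move=> [? ? ? ?] [? ? ? ?] [? ? ? ?]; congr Quat => /=; ring. Qed.
Lemma qone_neq0 : Quat 1 0 0 0 != 0 :> quat R.
Proof. by apply/eqP => -[] /eqP; rewrite oner_eq0. Qed.

HB.instance Definition _ := GRing.Zmodule_isNzRing.Build (quat R)
  qmulA qmul1l qmul1r qmulDl qmulDr qone_neq0.

Definition qreal (a : R) : quat R := Quat a 0 0 0.
Definition qconj q := Quat (qre q) (- qi q) (- qj q) (- qk q).
Definition qnorm2 q : R := qre q ^+ 2 + qi q ^+ 2 + qj q ^+ 2 + qk q ^+ 2.

(* q >= 0 (resp. q > 0) means that q is real and nonnegative (positive). *)
Definition qge0 q := [/\ qi q = 0, qj q = 0, qk q = 0 & 0 <= qre q].
Definition qgt0 q := [/\ qi q = 0, qj q = 0, qk q = 0 & 0 < qre q].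

End QuatRing.

Notation "x %:q" := (qreal x) : ring_scope.

(* A right vector space over the quaternions is a left module over the converse
   ring (quat R)^c; u ** q is the right multiplication of the vector u by q. *)
Definition rscale (R : realType) (V : lmodType (quat R)^c) (u : V) (q : quat R)
  : V := (q : (quat R)^c) *: u.

Notation "u ** q" := (rscale u q) : ring_scope.

Definition norm_of (R : realType) (V : Type) (ip : V -> V -> quat R) (u : V)
  : R := Num.sqrt (qre (ip u u)).

HB.mixin Record isQuatHilbert (R : realType) V
    of GRing.Lmodule ((quat R)^c) V := {
  inner : V -> V -> quat R;
  inner_conj : forall u v, qconj (inner u v) = inner v u;
  inner_gt0 : forall u, u != 0 -> qgt0 (inner u u);
  inner_linear : forall (u v w : V) (p q : quat R),
    inner u (rscale v p + rscale w q) = inner u v * p + inner u w * q;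
  inner_complete : forall x : nat -> V,
    (forall eps : R, 0 < eps ->
       \forall m & n \near \oo, norm_of inner (x m - x n) < eps) ->
    exists l : V, norm_of inner (x n - l) @[n --> \oo] --> (0 : R)
}.

#[short(type="quatHilbertType")]
HB.structure Definition QuatHilbert (R : realType) :=
  { V of isQuatHilbert R V & GRing.Lmodule ((quat R)^c) V }.

Section Operators.
Variables (R : realType) (H : quatHilbertType R).
Implicit Types (S T U : H -> H) (u v x : H) (q : quat R) (s t : R).

Definition hnorm u : R := norm_of (@inner R H) u.

(* The set of bounded right linear operators. *)
Definition BH : set (H -> H) := [set T |
  (forall u v q, T (u ** q + v) = T u ** q + T v) /\
  (exists M : R, forall u, hnorm (T u) <= M * hnorm u)].

Definition opnorm T : R := sup [set hnorm (T u) | u in [set u | hnorm u <= 1]].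

(* Exists (and is unique) for every T in BH, by Riesz representation. *)
Definition adjoint T : H -> H :=
  xget (fun=> 0) [set S | BH S /\ forall u v, inner (S u) v = inner u (T v)].

Definition positive T := forall x, qge0 (inner (T x) x).

Definition op_le S T := positive (T - S).

Definition Delta q T : H -> H :=
  fun u => T (T u) - T u ** (q + qconj q) + u ** (qnorm2 q)%:q.

Definition sigma_S T : set (quat R) :=
  [set q | ~ exists S, [/\ BH S, S \o Delta q T = id & Delta q T \o S = id]].

(* The real points of the spherical spectrum. For positive T this is the whole
   of sigma_S T, so that continuous real functions on sigma_S T are functions
   R -> R continuous on real_sigma_S T, up to equality on real_sigma_S T. *)
Definition real_sigma_S T : set R := [set s | sigma_S T s%:q].

(* Phi is the continuous functional calculus of T: a continuous unital
   homomorphism of real algebras from C(sigma_S T, R), with the sup norm, to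
   BH, with the operator norm, that sends the identity function to T. *)
Definition is_cfc T (Phi : (R -> R) -> (H -> H)) :=
  let K := real_sigma_S T in
  let C := [set f : R -> R | {within K, continuous f}] in
  [/\ (forall f, C f -> BH (Phi f)) /\
      (forall f g, C f -> C g ->
        (forall s, K s -> f s = g s) -> Phi f = Phi g),
      (forall f g, C f -> C g ->
        Phi (fun s => f s + g s) = (fun u => Phi f u + Phi g u)) /\
      (forall f c, C f -> Phi (fun s => c * f s) = (fun u => Phi f u ** c%:q)),
      (forall f g, C f -> C g -> Phi (fun s => f s * g s) = Phi f \o Phi g) /\
      Phi (fun=> 1) = id,
      Phi id = T
    & forall f, C f -> forall eps : R, 0 < eps ->
        exists2 delta : R, 0 < delta & forall g, C g ->
          (forall s, K s -> `|g s - f s| <= delta) ->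
          opnorm (Phi g - Phi f) <= eps].

(* For positive T in BH, is_cfc T determines cfc T f for every f that is
   continuous on the spectrum. *)
Definition cfc T : (R -> R) -> (H -> H) := xget (fun=> fun=> 0) (is_cfc T).

(* T^t, meant for positive T and t > 0. *)
Definition op_pow T t : H -> H := cfc T (fun s => s `^ t).

Definition op_abs T : H -> H := op_pow (adjoint T \o T) (2^-1).

Definition orthogonal_to (A : set H) : set H :=
  [set u | forall v, A v -> inner u v = 0].

Definition op_ker T : set H := [set u | T u = 0].

Definition polar_decomposition T U :=
  [/\ BH U, T = U \o op_abs T,
      forall u, orthogonal_to (op_ker (op_abs T)) u -> hnorm (U u) = hnorm u
    & forall u, op_ker (op_abs T) u -> U u = 0].

(* Meant for 0 < s <= 1. *)
Definition hyponormal s T :=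
  op_le (op_pow (T \o adjoint T) s) (op_pow (adjoint T \o T) s).

(* The Aluthge transform of T, where U is the polar factor of T. *)
Definition aluthge T U : H -> H :=
  op_pow (op_abs T) (2^-1) \o U \o op_pow (op_abs T) (2^-1).

End Operators.

(* Main.v *)
From HB Require Import structures.
Require Import Defs.
From mathcomp Require Import all_boot all_order all_algebra.
From mathcomp Require Import all_classical all_reals all_analysis.
From mathcomp Require Import complex.
From mathcomp Require Import ring lra.

(* Write X = |T|, h = 2 p and a = 1 / h.  Since U^* U X = X, both
   (T T^* )^p = (U X U^* )^h and (T^* T)^p = X^h, so p-hyponormality reads B <= A
   for A = X^h and B = (U X U^* )^h = U A U^*; compressing by U gives A <= U^* A U,
   and Hansen's inequality for the contraction U gives U^* A U <= C, where
   C = (U^* X U)^h.  The Aluthge transform L = X^(1/2) U X^(1/2) satisfies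
   L L^* = A^(a/2) B^a A^(a/2) and L^* L = A^(a/2) C^a A^(a/2), and both sides
   are compared with A^(1+a) by the Furuta inequality
     (A^(t/2) B^a A^(t/2))^((1+t)/(a+t)) <= A^(1+t)   when 0 <= B <= A, a >= 1, t >= 0
   and its reverse for C >= A, at t = a, where the exponent is p + 1/2.
   Furuta's inequality follows, for t <= 1, from the inequalities of Hansen and
   Loewner-Heinz, and iterating this case gives all t.

   Hansen's inequality [V^* X^t V <= Y^t if V^* X V <= Y] holds for x / (x + l) by
   a variational formula for resolvents, hence for x^t, a uniform limit of positive
   combinations of such functions.  The continuous functional calculus is obtained
   by completing the polynomial one: a polynomial that is nonnegative on the
   spectrum gives a positive operator, because the infimum of the form of a
   selfadjoint operator is not a regular value, and real polynomials split into
   factors of degree one and two. *)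

Set Implicit Arguments.
Unset Strict Implicit.
Unset Printing Implicit Defensive.

Import Order.TTheory GRing.Theory Num.Theory.
Import numFieldNormedType.Exports.
Local Open Scope classical_set_scope.
Local Open Scope ring_scope.

(** * Weierstrass approximation *)

(** All analysis takes place in the real Hilbert space given by [rip], the real part of the inner
    product. The quaternions return only at the boundary: right linearity recovers the other three
    components from real parts, so [adjoint], [op_le] and [orthogonal_to] can be exchanged with
    their real counterparts. This is also why polynomials are real and may have irreducible
    quadratic factors. The condition [p < 1/2] enters as [h < 1]: it makes [h] an admissible
    exponent in Hansen's inequality and [a = 1 / h] an admissible one in Furuta's. Two obstacles
    shape the rest. [cfc] is an arbitrary choice among functional calculi, so both existence and
    uniqueness have to be established before any power can be computed. And the contractions behind
    Furuta's inequality involve inverses such as [A^(-t/2)], whereas [X] may have a kernel; hence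
    the detour through [A + d] and [B + d], and a limit taken at the level of quadratic forms. *)

Section Weierstrass.
Variable R : realType.
Implicit Types (f g phi : R -> R) (x y z e M : R) (p : {poly R}).

(* The [n]-th Bernstein polynomial of [phi], as the expectation of [phi] at the
   number of successes in [n] independent trials. *)
Fixpoint bernstein n (phi : R -> R) : {poly R} :=
  if n is m.+1 then 'X * bernstein m (fun k => phi (k + 1)) + (1 - 'X) * bernstein m phi
  else (phi 0)%:P.

Lemma bernsteinS n phi x : (bernstein n.+1 phi).[x] =
  x * (bernstein n (fun k => phi (k + 1))).[x] + (1 - x) * (bernstein n phi).[x].
Proof. by rewrite /= !hornerE. Qed.

Lemma bernstein_le n f g x : 0 <= x <= 1 ->
  (forall k, (k <= n)%N -> f k%:R <= g k%:R) -> (bernstein n f).[x] <= (bernstein n g).[x].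
Proof.
move=> /andP[x0 x1]; elim: n f g => [|n IH] f g fg; first by rewrite !hornerC; exact: (fg 0%N).
rewrite !bernsteinS lerD// ler_wpM2l ?subr_ge0//; apply: IH => k kn.
  by rewrite natr1; apply: fg.
by apply: fg; rewrite leqW.
Qed.

Lemma bernstein_lin n (a : R) f g x :
  (bernstein n (fun k => a * f k + g k)).[x] = a * (bernstein n f).[x] + (bernstein n g).[x].
Proof.
elim: n f g => [|n IH] f g; first by rewrite !hornerC.
rewrite !bernsteinS (IH (fun k => f (k + 1)) (fun k => g (k + 1))) IH; ring.
Qed.

Lemma bernstein_cst n (a : R) x : (bernstein n (fun=> a)).[x] = a.
Proof. by elim: n => [|n IH]; rewrite ?hornerC// bernsteinS IH; ring. Qed.

(** Second moment of the binomial law: squared mean plus variance. The free shift [c] absorbs the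
    [k + 1] of the recursion. *)
Lemma bernstein_sqr n (c : R) x : (bernstein n (fun k => (k + c) ^+ 2)).[x] =
  (n%:R * x + c) ^+ 2 + n%:R * (x * (1 - x)).
Proof.
elim: n c => [|n IH] c; first by rewrite /= hornerC; ring.
rewrite bernsteinS IH (_ : (fun k => (k + 1 + c) ^+ 2) = (fun k => (k + (1 + c)) ^+ 2)).
  by rewrite IH -natr1; ring.
by apply/funext => k; rewrite addrA.
Qed.

(** Compactness in its near-covering form. Only [x] is confined to the interval; [y] may leave it,
    which is needed later when [x] is shifted by a small [d]. *)
Lemma heine f M e : continuous f -> 0 < e ->
  exists2 d, 0 < d & forall x y, 0 <= x <= M -> `|y - x| < d -> `|f y - f x| <= e.
Proof.
move=> cf e0.
have /compact_near_coveringP : compact `[0, M] := @segment_compact R 0 M.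
move=> /(_ R (nbhs (0:R)^'+) (fun d x => forall y, `|y - x| < d -> `|f y - f x| <= e)).
case=> [x _|d /= d0 dP].
  have /cvgrPdist_lt /(_ (e / 2)) := cf x; rewrite divr_gt0// => /(_ isT)[/= r r0 hr].
  exists (ball x (r / 2), [set d | d < r / 2]) => /=.
    by split; [exists (r / 2) => //=; rewrite divr_gt0 | apply: nbhs_right_lt; rewrite divr_gt0].
  move=> [x' d] /= [xx' dr] y yx'.
  have h1 := hr x'; have h2 := hr y; rewrite /= in h1 h2.
  have {}h1 : `|f x - f x'| < e / 2 by apply: h1; rewrite /ball /= in xx'; lra.
  have {}h2 : `|f x - f y| < e / 2.
    apply: h2; have -> : x - y = (x - x') - (y - x') by ring.
    by apply: le_lt_trans (ler_normB _ _) _; rewrite /ball /= in xx'; lra.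
  have -> : f y - f x' = (f x - f x') - (f x - f y) by ring.
  by apply: le_trans (ler_normB _ _) _; lra.
exists (d / 2); first by rewrite divr_gt0.
move=> x y xM yx; apply: (dP (d / 2)) => //=; rewrite ?divr_gt0//.
  by rewrite sub0r normrN gtr0_norm ?divr_gt0// ltr_pdivrMr// ltr_pMr// ltr1n.
Qed.

Lemma continuous_bounded_itv f M : continuous f ->
  exists2 B, 0 <= B & forall x, 0 <= x <= M -> `|f x| <= B.
Proof.
move=> cf; have [M0|M0] := leP 0 M; last first.
  by exists 0 => // x /andP[x0 xM]; move: (le_trans x0 xM); rewrite leNgt M0.
have cnf : {within `[0, M], continuous (fun x => `|f x|)}.
  by apply: continuous_subspaceT => x; apply: cvg_norm; exact: cf.
have [c _ hc] := EVT_max M0 cnf; exists `|f c| => // x xM; exact: hc.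
Qed.

Lemma weierstrass01 f e : continuous f -> 0 < e ->
  exists p, forall x, 0 <= x <= 1 -> `|p.[x] - f x| <= e.
Proof.
move=> cf e0; have e20 : 0 < e / 2 by rewrite divr_gt0.
have [d d0 hd] := @heine f 1 (e / 2) cf e20.
have [B B0 hB] := @continuous_bounded_itv f 1 cf.
(* At distance [d] or more, the trivial bound [2 * B] is at most [C * (y - x) ^+ 2]. One parabola
   therefore controls [f] everywhere, and the error reduces to the variance of the trials. *)
pose C : R := 2 * B / d ^+ 2.
have C0 : 0 <= C by rewrite divr_ge0 ?mulr_ge0// ltW// exprn_gt0.
have fC x y : 0 <= x <= 1 -> 0 <= y <= 1 -> `|f y - f x| <= e / 2 + C * (y - x) ^+ 2.
  move=> x01 y01; have [yx|dyx] := ltP `|y - x| d.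
    by apply: le_trans (hd _ _ x01 yx) _; rewrite lerDl mulr_ge0// sqr_ge0.
  apply: le_trans (ler_normB _ _) _.
  have := hB _ x01; have := hB _ y01.
  suff : 2 * B <= C * (y - x) ^+ 2 by lra.
  rewrite /C mulrAC ler_pdivlMr ?exprn_gt0// ler_wpM2l ?mulr_ge0//.
  by rewrite -[(y - x) ^+ 2]real_normK ?num_real// ler_pXn2r ?nnegrE// ltW.
pose n := (Num.truncn (C / (e / 2))).+1.
have n0 : 0 < n%:R :> R by rewrite ltr0n.
have Cn : C / n%:R <= e / 2.
  by rewrite ler_pdivrMr// mulrC -ler_pdivrMr// ltW// truncnS_gt.
exists (bernstein n (fun k => f (k / n%:R))) => x x01.
have kn k : (k <= n)%N -> 0 <= (k%:R / n%:R : R) <= 1.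
  by move=> kn; rewrite divr_ge0 ?ler0n//= ler_pdivrMr// mul1r ler_nat.
pose h (k : R) : R := e / 2 + C * (k / n%:R - x) ^+ 2.
have hE : (bernstein n h).[x] <= e.
  have -> : h = (fun k => C / n%:R ^+ 2 * (k + - (n%:R * x)) ^+ 2 + e / 2).
    by apply/funext => k; rewrite /h; field; rewrite gt_eqF.
  rewrite (bernstein_lin _ _ (fun k => (k + - (n%:R * x)) ^+ 2) (fun=> e / 2)).
  rewrite bernstein_sqr bernstein_cst subrr expr0n /= add0r.
  suff : C / n%:R ^+ 2 * (n%:R * (x * (1 - x))) <= e / 2 by lra.
  apply: le_trans Cn.
  rewrite (_ : _ * _ = C / n%:R * (x * (1 - x))); last by field; rewrite gt_eqF.
  have Cn0 : 0 <= C / n%:R by rewrite divr_ge0 ?ler0n.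
  rewrite -[leRHS]mulr1 ler_wpM2l//.
  by case/andP: x01 => x0 x1; rewrite mulr_ile1 ?subr_ge0// gerBl.
have bD : (bernstein n (fun k => f (k / n%:R) - f x)).[x] =
    (bernstein n (fun k => f (k / n%:R))).[x] - f x.
  have := bernstein_lin n (-1) (fun=> f x) (fun k => f (k / n%:R)) x.
  rewrite bernstein_cst mulN1r addrC => <-.
  by congr (bernstein _ _).[_]; apply/funext => k; ring.
have {}fC k : (k <= n)%N -> `|f (k%:R / n%:R) - f x| <= h k%:R by move=> /kn; exact: fC.
rewrite -bD ler_norml; apply/andP; split.
  apply: le_trans (_ : - (bernstein n h).[x] <= _); first by rewrite lerN2.
  rewrite -mulN1r -[leLHS]addr0 -(bernstein_cst n 0 x) -bernstein_lin.
  apply: bernstein_le => // k /fC; rewrite ler_norml => /andP[+ _].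
  by rewrite mulN1r addr0.
apply: le_trans hE; apply: bernstein_le => // k /fC.
by rewrite ler_norml => /andP[].
Qed.

Lemma weierstrass f M e : continuous f -> 0 < e ->
  exists p, forall x, 0 <= x <= M -> `|p.[x] - f x| <= e.
Proof.
move=> cf e0; pose N := Num.max M 1.
have N0 : 0 < N by rewrite lt_max ltr01 orbT.
have [|p hp] := @weierstrass01 (fun x => f (N * x)) e _ e0.
  by move=> x; apply: continuous_comp; [exact: mulrl_continuous | exact: cf].
exists (p \Po (N^-1 *: 'X)) => x /andP[x0 xM]; rewrite horner_comp !hornerE.
have := hp (N^-1 * x); rewrite mulrA mulfV ?gt_eqF// mul1r; apply.
rewrite mulr_ge0 ?invr_ge0 ?(ltW N0)//= mulrC ler_pdivrMr// mul1r.
by apply: le_trans xM _; rewrite le_max lexx.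
Qed.

Lemma weierstrass_within (K : set R) f M e : closed K -> (forall x, K x -> 0 <= x <= M) ->
  {within K, continuous f} -> 0 < e ->
  exists p, forall x, K x -> `|p.[x] - f x| <= e.
Proof.
move=> cK KM cf e0.
have cptK : compact K.
  apply: (subclosed_compact cK (@segment_compact R 0 M)) => x /KM.
  by rewrite /= in_itv.
have [B B0 hB] : exists2 B, 0 < B & forall x, K x -> `|f x| <= B.
  have /compact_bounded[B [Br hB]] := continuous_compact cf cptK.
  exists (`|B| + 1) => [|x Kx]; first by rewrite ltr_wpDl.
  by apply: hB; [rewrite (le_lt_trans (ler_norm _))// ltrDl | exists x].
(* Tietze's theorem *)
have [||g [fg cg _]] := continuous_bounded_extension _ _ B0 cf hB.
- exact: pseudometric_normal.
- exact: cK.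
have [p hp] := weierstrass M cg e0; exists p => x Kx.
by rewrite (fg x) ?inE//; apply: hp; exact: KM.
Qed.

Lemma continuous_normr_powR (t : R) : 0 <= t -> continuous (fun x : R => `|x| `^ t).
Proof.
move=> t0 x; have [->|tN0] := eqVneq t 0.
  by under [X in continuous_at _ X]eq_fun do rewrite powRr0; exact: cvg_cst.
have {t0 tN0} t0 : 0 < t by rewrite lt_neqAle eq_sym tN0.
have [->|x0] := eqVneq x 0.
  apply/cvgrPdist_lt => e e0; exists (e `^ t^-1) => /=; first exact: powR_gt0.
  move=> y /=; rewrite sub0r normrN normr0 powR0 ?gt_eqF// sub0r normrN => ye.
  rewrite ger0_norm ?powR_ge0//.
  have -> : e = (e `^ t^-1) `^ t by rewrite -powRrM mulVf ?gt_eqF// powRr1// ltW.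
  by apply: gt0_ltr_powR; rewrite ?nnegrE ?powR_ge0.
apply: (@continuous_comp R R R (fun y => `|y|) (fun y => y `^ t)); first exact: norm_continuous.
apply/differentiable_continuous/derivable1_diffP/derivable_powR.
by rewrite in_itv /= andbT normr_gt0.
Qed.

End Weierstrass.

(** * Fractional powers as limits of sums of resolvents *)

Section FractionalPower.
Variable R : realType.
Implicit Types (x y t e M : R) (n N : nat).

Lemma expr_small (z e : R) : 0 <= z -> z < 1 -> 0 < e -> exists n, z ^+ n < e.
Proof.
move=> z0 z1 e0; have : (z ^+ n @[n --> \oo] --> (0 : R))%classic.
  by apply: cvg_expr; rewrite ger0_norm.
move=> /cvgrPdist_lt /(_ e e0)[N _ hN]; exists N.
by have := hN N (leqnn _); rewrite sub0r normrN ger0_norm ?exprn_ge0.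
Qed.

Section GeometricSum.
Variables a q : R.
Hypotheses (a1 : 1 < a) (aq : a < q).

(* A discretisation, at the points [l = q ^ k], of the integral of
   [l ^ (t - 1) * x / (x + l)], where [a = q ^ t]; it is homogeneous of degree
   [t] for the dilations by powers of [q]. *)
Let w N i x : R := a ^+ i / a ^+ N * (x / (x + q ^+ i / q ^+ N)).
Let S N x : R := \sum_(i < N.*2) w N i x.
(** Common decay rate of the two tails: [a^-1] for small [l], [a / q] for large [l]. *)
Let rho : R := Num.max a^-1 (a / q).

Let a0 : 0 < a. Proof. exact: lt_trans a1. Qed.
Let q0 : 0 < q. Proof. exact: lt_trans aq. Qed.
Let aN0 n : 0 < a ^+ n. Proof. exact: exprn_gt0. Qed.
Let qN0 n : 0 < q ^+ n. Proof. exact: exprn_gt0. Qed.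
Let l0 i N : 0 < q ^+ i / q ^+ N. Proof. exact: divr_gt0. Qed.
Let rho0 : 0 < rho. Proof. by rewrite lt_max invr_gt0 a0. Qed.
Let rho1 : rho < 1. Proof. by rewrite gt_max invf_lt1// a1 ltr_pdivrMr// mul1r. Qed.

Let w_ge0 N i x : 0 <= x -> 0 <= w N i x.
Proof.
move=> x0; rewrite mulr_ge0//; first by rewrite ltW// divr_gt0.
by rewrite divr_ge0// addr_ge0// ltW.
Qed.

Let wS N i x : w N.+1 i.+1 x = w N i x.
Proof. by rewrite /w !exprS -!mulf_div !divff ?mul1r// gt_eqF. Qed.

Let wM N i x : w N i (q * x) = a * w N.+1 i x.
Proof.
rewrite /w !exprS; have -> : q * x / (q * x + q ^+ i / q ^+ N) = x / (x + q ^+ i / (q * q ^+ N)).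
  rewrite (_ : q * x + _ = q * (x + q ^+ i / (q * q ^+ N))).
    by rewrite -mulf_div divff ?mul1r// gt_eqF.
  by field; rewrite !gt_eqF.
by move: (x / _) => z; field; rewrite !gt_eqF.
Qed.

Let w_mono N i x y : 0 <= x -> x <= y -> w N i x <= w N i y.
Proof.
move=> x0 xy; have y0 := le_trans x0 xy.
have c0 : 0 <= a ^+ i / a ^+ N by rewrite ltW// divr_gt0.
have l_gt0 := l0 i N; have xl : 0 < x + q ^+ i / q ^+ N by rewrite ltr_wpDl.
have yl : 0 < y + q ^+ i / q ^+ N by rewrite ltr_wpDl.
rewrite ler_wpM2l// ler_pdivrMr// mulrAC ler_pdivlMr// !mulrDr [y * x]mulrC lerD2l.
by rewrite ler_wpM2r// ltW.
Qed.

(** The exponents run over [-N <= k < N], so enlarging [N] by one adds one term at each end. *)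
Let SS N x : S N.+1 x = S N x + (w N.+1 0 x + w N.+1 N.*2.+1 x).
Proof.
rewrite /S doubleS big_ord_recl big_ord_recr /= addrCA; congr (_ + _).
by apply: eq_bigr => i _; rewrite [bump 0 i]add1n wS.
Qed.

Let S_ge0 N x : 0 <= x -> 0 <= S N x.
Proof. by move=> x0; apply: sumr_ge0 => i _; exact: w_ge0. Qed.

Let S_mono N x y : 0 <= x -> x <= y -> S N x <= S N y.
Proof. by move=> x0 xy; apply: ler_sum => i _; exact: w_mono. Qed.

(** At the small end [x / (x + l)] is bounded by [1], at the large end by [x / l]. *)
Let S_incr N x : 0 <= x -> S N x <= S N.+1 x <= S N x + (x + 1) * rho ^+ N.
Proof.
move=> x0; rewrite SS lerDl addr_ge0 ?w_ge0//= lerD2l mulrDl mul1r addrC lerD//.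
  have -> : w N.+1 N.*2.+1 x = a ^+ N * (x / (x + q ^+ N)).
    have E (z : R) : z != 0 -> z ^+ N.*2.+1 / z ^+ N.+1 = z ^+ N.
      by move=> z0; rewrite -addnn -addnS exprD mulfK// expf_neq0.
    by rewrite /w !E// gt_eqF.
  rewrite mulrCA ler_wpM2l//; apply: (@le_trans _ _ ((a / q) ^+ N)).
    rewrite exprMn exprVn ler_wpM2l ?lef_pV2 ?posrE ?lerDr ?ltr_wpDl//; exact: ltW.
  by rewrite lerXn2r ?nnegrE ?(ltW rho0) ?divr_ge0 ?(ltW a0) ?(ltW q0)// le_max lexx orbT.
apply: (@le_trans _ _ (a^-1 ^+ N.+1)).
  have xl : x / (x + q ^+ 0 / q ^+ N.+1) <= 1.
    by rewrite ler_pdivrMr ?ltr_wpDl// mul1r lerDl ltW.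
  rewrite /w [a ^+ 0]expr0 [1 / a ^+ _]mul1r exprVn -[leRHS]mulr1.
  by rewrite ler_wpM2l// invr_ge0 ltW.
apply: (@le_trans _ _ (rho ^+ N.+1)).
  by rewrite lerXn2r ?nnegrE ?invr_ge0 ?(ltW rho0) ?(ltW a0)// le_max lexx.
by rewrite exprS ger_pMl ?exprn_gt0// ltW.
Qed.

Let S_tail N k x : 0 <= x -> S (N + k) x <= S N x + (x + 1) / (1 - rho) * rho ^+ N.
Proof.
move=> x0; have r0 : 0 < 1 - rho by rewrite subr_gt0.
have x1 : 0 <= x + 1 by rewrite addr_ge0.
elim: k N => [|k IH] N.
  by rewrite addn0 lerDl !mulr_ge0 ?invr_ge0 ?exprn_ge0 ?(ltW r0) ?(ltW rho0).
rewrite addnS -addSn; apply: le_trans (IH _) _; case/andP: (S_incr N x0) => _ h.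
rewrite (_ : _ / _ * rho ^+ N = (x + 1) * rho ^+ N + (x + 1) / (1 - rho) * rho ^+ N.+1).
  by rewrite addrA lerD2r.
by rewrite exprS; field; rewrite gt_eqF.
Qed.

Let Srange x := [set S N x | N in [set: nat]].

Let Srange_sup x : 0 <= x -> has_sup (Srange x).
Proof.
move=> x0; split; first by exists (S 0 x), 0%N.
exists (S 0 x + (x + 1) / (1 - rho)) => _ [N _ <-].
by have := S_tail 0 N x0; rewrite expr0 mulr1 add0n.
Qed.

Let G x : R := sup (Srange x).

Let S_le_G N x : 0 <= x -> S N x <= G x.
Proof. by move=> x0; apply: sup_upper_bound; [exact: Srange_sup | exists N]. Qed.

Let G_le x y : 0 <= x -> (forall N, S N x <= y) -> G x <= y.
Proof.
move=> x0 Sy; apply: ge_sup; first by case: (Srange_sup x0).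
by move=> _ [N _ <-].
Qed.

Let G_tail N x : 0 <= x -> G x <= S N x + (x + 1) / (1 - rho) * rho ^+ N.
Proof.
move=> x0; apply: G_le => // m; have [Nm|mN] := leqP N m.
  by rewrite -(subnKC Nm); exact: S_tail.
apply: le_trans (_ : S N x <= _).
  elim: N mN => // N IH; rewrite ltnS leq_eqVlt => /predU1P[->|/IH]; first by case/andP: (S_incr N x0).
  by move/le_trans; apply; case/andP: (S_incr N x0).
have r0 : 0 < 1 - rho by rewrite subr_gt0.
by rewrite lerDl !mulr_ge0 ?invr_ge0 ?exprn_ge0 ?(ltW r0) ?(ltW rho0)// addr_ge0.
Qed.

Let G_mono x y : 0 <= x -> x <= y -> G x <= G y.
Proof.
move=> x0 xy; apply: G_le => // N; apply: le_trans (S_mono N x0 xy) _.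
exact: S_le_G (le_trans x0 xy).
Qed.

Let SqM N x : S N (q * x) = a * \sum_(i < N.*2) w N.+1 i x.
Proof. by rewrite /S mulr_sumr; apply: eq_bigr => i _; rewrite wM. Qed.

Let SqM_le N x : 0 <= x -> S N (q * x) <= a * S N.+1 x.
Proof.
move=> x0; rewrite SqM ler_wpM2l ?(ltW a0)// /S doubleS 2!big_ord_recr /=.
by rewrite -addrA lerDl addr_ge0 ?w_ge0.
Qed.

Let SqM_ge N x : 0 <= x -> a * S N x <= S N.+1 (q * x).
Proof.
move=> x0; rewrite SqM ler_wpM2l ?(ltW a0)// /S doubleS 2!big_ord_recl addrA.
have -> : \sum_(i < N.*2) w N i x = \sum_(i < N.*2) w N.+2 (lift ord0 (lift ord0 i)) x.
  by apply: eq_bigr => i _; rewrite !lift0 !wS.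
by rewrite lerDr addr_ge0 ?w_ge0.
Qed.

(** Dilation by [q] only shifts the window of exponents. For finite sums this costs end terms,
    absorbed by passing from [N] to [N + 1]; for the supremum the homogeneity is exact. *)
Let GqM x : 0 <= x -> G (q * x) = a * G x.
Proof.
move=> x0; have qx0 : 0 <= q * x by rewrite mulr_ge0// ltW.
apply: le_anti; apply/andP; split.
  apply: G_le => // N; apply: le_trans (SqM_le N x0) _.
  by rewrite ler_pM2l// S_le_G.
rewrite -ler_pdivlMl//; apply: G_le => // N; rewrite ler_pdivlMl//.
exact: le_trans (SqM_ge N x0) (S_le_G _ qx0).
Qed.

Let GqXM n x : 0 <= x -> G (q ^+ n * x) = a ^+ n * G x.
Proof.
move=> x0; elim: n => [|n IH]; first by rewrite !expr0 !mul1r.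
by rewrite !exprS -!mulrA GqM ?IH// mulr_ge0// ltW.
Qed.

Let G1_gt0 : 0 < G 1.
Proof.
apply: lt_le_trans (S_le_G 1 ler01).
rewrite /S big_ord_recl; apply: ltr_pwDl; last by apply: sumr_ge0 => i _; exact: w_ge0.
have l_gt0 := l0 0 1; rewrite /w mulr_gt0//; first exact: divr_gt0.
by rewrite divr_gt0// addr_gt0.
Qed.

(** [G] and the [t]-th power are monotone, and both gain the factor [a] under dilation by [q].
    Between consecutive powers of [q] they can thus differ, after normalisation by [G 1], only by a
    factor [a]. Multiplying first by [q ^+ n] brings [x] above [1], where natural exponents
    suffice. *)
Let G_powR t x : a = q `^ t -> 0 <= t -> 0 < x ->
  G x <= a * (x `^ t * G 1) /\ x `^ t * G 1 <= a * G x.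
Proof.
move=> at_ t0 x0; have powq n : (q ^+ n) `^ t = a ^+ n.
  elim: n => [|n IH]; first by rewrite !expr0 powR1.
  by rewrite !exprS powRM ?IH -?at_// ltW.
have qV : 0 <= q^-1 by rewrite invr_ge0 ltW.
have qV1 : q^-1 < 1 by rewrite invf_lt1// (lt_trans a1).
have [n qx] := expr_small qV qV1 x0; pose y : R := q ^+ n * x.
have y1 : 1 <= y by rewrite /y mulrC -ler_pdivrMr// div1r -exprVn ltW.
have y0 : 0 < y by exact: lt_le_trans y1.
have [m1 qy] : exists m, y < q ^+ m.
  have [m qm] : exists m, q^-1 ^+ m < y^-1 by apply: expr_small; rewrite ?invr_gt0.
  by exists m; move: qm; rewrite exprVn ltf_pV2 ?posrE.
have [m ym mmin] := ex_minnP (ex_intro (fun m => y < q ^+ m) m1 qy).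
case: m ym mmin => [|m] ym mmin; first by move: ym; rewrite expr0 ltNge y1.
have my : q ^+ m <= y by rewrite leNgt; apply/negP => /mmin; rewrite ltnn.
have Gup : G y <= a ^+ m.+1 * G 1.
  by rewrite -GqXM// mulr1 G_mono ?(ltW y0) ?(ltW ym).
have Glo : a ^+ m * G 1 <= G y by rewrite -GqXM// mulr1 G_mono ?(ltW (qN0 _)).
have ylo : a ^+ m <= y `^ t.
  by rewrite -powq ge0_ler_powR ?nnegrE// ltW.
have yup : y `^ t <= a ^+ m.+1.
  by rewrite -powq ge0_ler_powR ?nnegrE// ltW.
have yt : y `^ t = a ^+ n * x `^ t by rewrite /y powRM ?powq ?(ltW (qN0 _)) ?(ltW x0).
have Gy : G y = a ^+ n * G x by rewrite /y GqXM// ltW.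
split; rewrite -(ler_pM2l (aN0 n)).
  rewrite -Gy [leRHS](_ : _ = a * (y `^ t * G 1)); last by rewrite yt; ring.
  by apply: le_trans Gup _; rewrite exprS -!mulrA ler_pM2l// ler_pM2r.
rewrite [leRHS]mulrCA -Gy mulrA -yt; apply: (@le_trans _ _ (a ^+ m.+1 * G 1)).
  by rewrite ler_pM2r.
by rewrite exprS -mulrA ler_pM2l.
Qed.

Lemma geometric_sum_approx t M e : a = q `^ t -> 0 < t -> 0 <= M -> 0 < e ->
  exists s : seq (R * R), (forall cl, cl \in s -> 0 <= cl.1 /\ 0 < cl.2) /\
  forall x, 0 <= x <= M ->
    `|x `^ t - \sum_(cl <- s) cl.1 * (x / (x + cl.2))| <= (a - 1) * x `^ t + e.
Proof.
move=> at_ t0 M0 e0; have r0 : 0 < 1 - rho by rewrite subr_gt0.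
pose C : R := (M + 1) / (1 - rho) / G 1.
have C0 : 0 < C by rewrite !divr_gt0// ltr_wpDl.
have [N hN] := expr_small (ltW rho0) rho1 (divr_gt0 e0 C0).
have CN : C * rho ^+ N <= e by rewrite mulrC -ler_pdivlMr// ltW.
exists [seq (a ^+ i / a ^+ N / G 1, q ^+ i / q ^+ N) | i <- iota 0 N.*2]; split.
  by move=> _ /mapP[i _ ->] /=; rewrite divr_gt0// ltW// !divr_gt0.
move=> x /andP[x0 xM]; rewrite big_map.
have -> : \sum_(i <- iota 0 N.*2) a ^+ i / a ^+ N / G 1 * (x / (x + q ^+ i / q ^+ N)) = S N x / G 1.
  rewrite /S mulr_suml -(big_mkord predT (fun i => w N i x / G 1)) /index_iota subn0.
  by apply: eq_bigr => i _; rewrite /w mulrAC.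
have tail : G x / G 1 - S N x / G 1 <= e.
  apply: le_trans CN; rewrite -mulrBl /C -mulrA [_^-1 * rho ^+ N]mulrC mulrA ler_wpM2r ?invr_ge0 ?(ltW G1_gt0)//.
  rewrite lerBlDl; apply: le_trans (G_tail N x0) _; rewrite lerD2l ler_wpM2r ?exprn_ge0 ?(ltW rho0)//.
  by rewrite ler_wpM2r ?invr_ge0 ?(ltW r0)// lerD2r.
have SG : S N x / G 1 <= G x / G 1 by rewrite ler_wpM2r ?invr_ge0 ?(ltW G1_gt0)// S_le_G.
have [Gup Glo] : G x / G 1 <= a * x `^ t /\ x `^ t <= a * (G x / G 1).
  have [xeq0|xN0] := eqVneq x 0.
    rewrite xeq0 powR0 ?gt_eqF// mulr0; have := GqM (lexx 0); rewrite mulr0 => G0.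
    have {}G0 : G 0 = 0.
      apply/eqP; move/eqP: G0; rewrite -subr_eq0 -{1}[G 0]mul1r -mulrBl mulf_eq0 subr_eq0.
      by rewrite lt_eqF.
    by rewrite G0 mul0r mulr0.
  have [|Gup Glo] := G_powR at_ (ltW t0) (x := x); first by rewrite lt_neqAle eq_sym xN0.
  by rewrite ler_pdivrMr// mulrA ler_pdivlMr// -mulrA.
have xt0 : 0 <= x `^ t by exact: powR_ge0.
have Gx0 : 0 <= G x / G 1 by rewrite divr_ge0 ?(ltW G1_gt0)// (le_trans (S_ge0 0 x0))// S_le_G.
(* [2 - a] stands in for [a^-1], since [a * (2 - a) <= 1]; both the upper and the lower relative
   errors then become [a - 1]. *)
have a21 : x `^ t * (2 - a) <= G x / G 1.
  have [a2|a2] := leP a 2; last by apply: le_trans Gx0; rewrite mulr_ge0_le0// subr_le0 ltW.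
  have a20 : 0 <= 2 - a by rewrite subr_ge0.
  apply: le_trans (ler_wpM2r a20 Glo) _; rewrite mulrAC -[leRHS]mul1r ler_wpM2r//.
  by have := sqr_ge0 (a - 1); lra.
by rewrite ler_norml; apply/andP; split; lra.
Qed.

End GeometricSum.

Lemma powR_approx t M e : 0 < t < 1 -> 0 <= M -> 0 < e ->
  exists s : seq (R * R), (forall cl, cl \in s -> 0 <= cl.1 /\ 0 < cl.2) /\
  forall x, 0 <= x <= M -> `|x `^ t - \sum_(cl <- s) cl.1 * (x / (x + cl.2))| <= e.
Proof.
move=> /andP[t0 t1] M0 e0; have e2 : 0 < e / 2 by rewrite divr_gt0.
(* With ratio [q = 1 + d] the relative error is at most [d], because [t < 1] gives a [t]-th power of
   [q] below [q]; and the power of [x] is at most [M + 1] on the interval. *)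
pose d : R := e / 2 / (M + 1); have d0 : 0 < d by rewrite divr_gt0// ltr_wpDl.
pose q : R := 1 + d; have q1 : 1 < q by rewrite ltrDl.
have E1 : (1 : R) `^ t = 1 by rewrite powR1.
have a1 : 1 < q `^ t by rewrite -[X in X < _]E1 gt0_ltr_powR// nnegrE ltW// (lt_trans ltr01).
have q0 : 0 < q by exact: lt_trans q1.
have aq : q `^ t < q.
  by rewrite -{2}(powRr1 (ltW q0)) /powR gt_eqF// ltr_expR ltr_pM2r// ln_gt0.
have [s [s0 hs]] := geometric_sum_approx a1 aq erefl t0 M0 e2.
exists s; split => // x xM; apply: le_trans (hs x xM) _.
suff : (q `^ t - 1) * x `^ t <= e / 2 by lra.
have -> : e / 2 = d * (M + 1) by rewrite divfK// gt_eqF// ltr_wpDl.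
case/andP: xM => x0 xM; apply: ler_pM; rewrite ?subr_ge0 ?powR_ge0 ?(ltW a1)//.
  by rewrite lerBlDl ltW.
have [x1|x1] := leP x 1.
  apply: (@le_trans _ _ 1); last by rewrite lerDr.
  by rewrite -[leRHS]E1 ge0_ler_powR ?nnegrE// ltW.
apply: (@le_trans _ _ x); last by rewrite (le_trans xM)// lerDl.
by rewrite -{2}(powRr1 x0) ler_powR// ltW.
Qed.

End FractionalPower.

(** * Real inner product *)

Section RealInner.
Variables (R : realType) (H : quatHilbertType R).
Implicit Types (u v w : H) (q : quat R) (a b : R).

(** A real inner product with the same norm. Self-duality, symmetry and order of operators are all
    studied through it. *)
Definition rip u v : R := qre (inner u v).

Lemma rip_def u v : rip u v = qre (inner u v). Proof. by []. Qed.

Lemma rscaleDr u p q : u ** (p + q) = u ** p + u ** q.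
Proof. exact: scalerDl. Qed.

Lemma rscaleDl u v q : (u + v) ** q = u ** q + v ** q.
Proof. exact: scalerDr. Qed.

Lemma rscaleM u p q : u ** p ** q = u ** (p * q).
Proof. exact: scalerA. Qed.

Lemma rscale1 u : u ** 1 = u.
Proof. exact: scale1r. Qed.

Lemma rscale0 q : (0 : H) ** q = 0.
Proof. exact: scaler0. Qed.

Lemma rscaleN u q : (- u) ** q = - (u ** q).
Proof. exact: scalerN. Qed.

Lemma inner_DZ u v w p q : inner u (v ** p + w ** q) = inner u v * p + inner u w * q.
Proof. exact: inner_linear. Qed.

Lemma innerDr u v w : inner u (v + w) = inner u v + inner u w.
Proof. by have := inner_DZ u v w 1 1; rewrite !rscale1 !mulr1. Qed.

Lemma innerZr u v q : inner u (v ** q) = inner u v * q.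
Proof. by have := inner_DZ u v 0 q 0; rewrite rscale0 addr0 mulr0 addr0. Qed.

Lemma qconjM p q : qconj (p * q) = qconj q * qconj p.
Proof. by case: p => ????; case: q => ????; congr Quat => /=; ring. Qed.

Lemma qconjK : involutive (@qconj R).
Proof. by case=> ????; rewrite /qconj /= !opprK. Qed.

Lemma qre_conj q : qre (qconj q) = qre q. Proof. by []. Qed.

Lemma qreMC p q : qre (p * q) = qre (q * p).
Proof. by case: p => ????; case: q => ???? /=; ring. Qed.

Lemma qmulZ a q : a%:q * q = q * a%:q.
Proof. by case: q => ????; congr Quat => /=; ring. Qed.

Lemma qreMr a q : qre (q * a%:q) = a * qre q.
Proof. by case: q => ???? /=; ring. Qed.

Lemma qrealD a b : (a + b)%:q = a%:q + b%:q.
Proof. by congr Quat; rewrite addr0. Qed.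

Lemma qrealM a b : (a * b)%:q = a%:q * b%:q.
Proof. by congr Quat => /=; ring. Qed.

Lemma qconj_real a : qconj a%:q = a%:q.
Proof. by rewrite /qconj /= !oppr0. Qed.

Lemma innerC u v : qconj (inner u v) = inner v u.
Proof. exact: inner_conj. Qed.

Lemma ripC u v : rip u v = rip v u.
Proof. by rewrite /rip -innerC. Qed.

Lemma ripDr u v w : rip u (v + w) = rip u v + rip u w.
Proof. by rewrite /rip innerDr. Qed.

Lemma ripDl u v w : rip (v + w) u = rip v u + rip w u.
Proof. by rewrite ripC ripDr !(ripC u). Qed.

Lemma ripZr u v a : rip u (v ** a%:q) = a * rip u v.
Proof. by rewrite /rip innerZr qreMr. Qed.

Lemma ripZl u v a : rip (u ** a%:q) v = a * rip u v.
Proof. by rewrite ripC ripZr ripC. Qed.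

Lemma ripMr u v q : rip u (v ** q) = rip (u ** qconj q) v.
Proof.
rewrite /rip innerZr -[inner (u ** _) v]innerC innerZr qre_conj.
by rewrite -[inner v u]innerC -qconjM qre_conj qreMC.
Qed.

Lemma ripr0 u : rip u 0 = 0.
Proof. by have := ripZr u 0 0; rewrite rscale0 mul0r. Qed.

Lemma rip0l u : rip 0 u = 0.
Proof. by rewrite ripC ripr0. Qed.

Lemma ripNr u v : rip u (- v) = - rip u v.
Proof. by apply/eqP; rewrite -addr_eq0 -ripDr addNr ripr0. Qed.

Lemma ripNl u v : rip (- u) v = - rip u v.
Proof. by rewrite ripC ripNr ripC. Qed.

Definition ripE := (ripDr, ripDl, ripZr, ripZl, ripNr, ripNl).

Lemma rip_gt0 u : u != 0 -> 0 < rip u u.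
Proof. by case/inner_gt0. Qed.

Lemma rip_ge0 u : 0 <= rip u u.
Proof. by have [->|/rip_gt0/ltW//] := eqVneq u 0; rewrite ripr0. Qed.

Lemma rip_eq0 u : rip u u = 0 -> u = 0.
Proof. by have [//|/rip_gt0 + u0] := eqVneq u 0; rewrite u0 ltxx. Qed.

Lemma rip_inj u v : (forall w, rip u w = rip v w) -> u = v.
Proof.
move=> uv; apply/eqP; rewrite -subr_eq0; apply/eqP/rip_eq0.
by rewrite ripDl uv ripNl addrN.
Qed.

(* The components of [q] are recovered as real parts of [q], [q i], [q j], [q k]. *)
Lemma rip_inner u v u' v' :
  (forall q, rip u (v ** q) = rip u' (v' ** q)) -> inner u v = inner u' v'.
Proof.
move=> h; have {}h q : qre (inner u v * q) = qre (inner u' v' * q).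
  by rewrite -!innerZr; apply: h.
move: (h 1) (h (Quat 0 1 0 0)) (h (Quat 0 0 1 0)) (h (Quat 0 0 0 1)).
case: (inner u v) => a b c d; case: (inner u' v') => a' b' c' d' /=.
by rewrite !mulr1 !mulr0 => *; congr Quat; lra.
Qed.

Lemma hnormE u : hnorm u = Num.sqrt (rip u u). Proof. by []. Qed.

Lemma hnorm_ge0 u : 0 <= hnorm u. Proof. exact: sqrtr_ge0. Qed.

Lemma sqr_hnorm u : hnorm u ^+ 2 = rip u u.
Proof. by rewrite hnormE sqr_sqrtr ?rip_ge0. Qed.

Lemma hnorm0 : hnorm (0 : H) = 0.
Proof. by rewrite hnormE ripr0 sqrtr0. Qed.

Lemma hnorm_eq0 u : hnorm u = 0 -> u = 0.
Proof. by move=> u0; apply: rip_eq0; rewrite -sqr_hnorm u0 expr0n. Qed.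

Lemma hnormN u : hnorm (- u) = hnorm u.
Proof. by rewrite !hnormE ripNl ripNr opprK. Qed.

Lemma hnormZ u a : hnorm (u ** a%:q) = `|a| * hnorm u.
Proof.
by rewrite !hnormE !ripE mulrA -expr2 sqrtrM ?sqr_ge0// sqrtr_sqr.
Qed.

Lemma discriminant_le (a b c : R) : 0 <= c ->
  (forall t : R, 0 <= a + 2 * t * b + t ^+ 2 * c) -> b ^+ 2 <= a * c.
Proof.
move=> c0 h; have [c00|cN0] := eqVneq c 0.
  have [->|b0] := eqVneq b 0; first by rewrite expr0n mulr_ge0//; have := h 0; lra.
  (* For [c = 0] the expression is affine in [t] and equals [-1] at this point. *)
  have := h (- (a + 1) / (2 * b)); rewrite c00 mulr0 addr0.
  rewrite (_ : 2 * _ * b = - (a + 1)); last by field.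
  lra.
have := h (- b / c); rewrite (_ : _ + _ = (a * c - b ^+ 2) / c); last by field.
by rewrite pmulr_lge0 ?subr_ge0// invr_gt0 lt_neqAle eq_sym cN0.
Qed.

Lemma cauchy_schwarz u v : rip u v ^+ 2 <= rip u u * rip v v.
Proof.
apply: discriminant_le => [|t]; first exact: rip_ge0.
have := rip_ge0 (u + v ** t%:q); rewrite !ripE (ripC v u).
by move=> /le_trans; apply; rewrite le_eqVlt; apply/orP; left; apply/eqP; ring.
Qed.

Lemma rip_le_hnorm u v : `|rip u v| <= hnorm u * hnorm v.
Proof.
rewrite !hnormE -sqrtrM ?rip_ge0// -sqrtr_sqr.
by rewrite ler_wsqrtr// cauchy_schwarz.
Qed.

Lemma ler_rip u v : rip u v <= hnorm u * hnorm v.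
Proof. exact: le_trans (ler_norm _) (rip_le_hnorm u v). Qed.

Lemma hnorm_le (x : R) u : 0 <= x -> (hnorm u <= x) = (rip u u <= x ^+ 2).
Proof. by move=> x0; rewrite -sqr_hnorm ler_sqr ?nnegrE// hnorm_ge0. Qed.

Lemma hnormD u v : hnorm (u + v) <= hnorm u + hnorm v.
Proof.
rewrite hnorm_le ?addr_ge0 ?hnorm_ge0//.
rewrite !ripE (ripC v u) sqrrD !sqr_hnorm.
by have := ler_rip u v; lra.
Qed.

Lemma hnormB u v : hnorm (u - v) = hnorm (v - u).
Proof. by rewrite -hnormN opprB. Qed.

End RealInner.

(** * The ring of bounded operators *)

Section BoundedOperators.
Variables (R : realType) (H : quatHilbertType R).
Implicit Types (u v w x : H) (q : quat R) (a b c : R).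

(** Bundling makes the bounded operators a ring and a real vector space, so that algebraic rewriting
    applies to them. *)
Record bop := Bop { bfun :> H -> H; bopP : BH bfun }.

Lemma bop_eq (F G : bop) : (forall u, F u = G u) -> F = G.
Proof.
case: F G => [f hf] [g hg] /= /funext fg.
by rewrite fg in hf *; congr Bop; exact: Prop_irrelevance.
Qed.

HB.instance Definition _ := gen_eqMixin bop.
HB.instance Definition _ := gen_choiceMixin bop.

Implicit Types F G K : bop.

Lemma bop_lin F u v q : F (u ** q + v) = F u ** q + F v.
Proof. by case: (bopP F). Qed.

Lemma bopDr F u v : F (u + v) = F u + F v.
Proof. by have := bop_lin F u v 1; rewrite !rscale1. Qed.

Lemma bop0r F : F 0 = 0.
Proof. by apply: (addrI (F 0)); rewrite -bopDr !addr0. Qed.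

Lemma bopZr F u q : F (u ** q) = F u ** q.
Proof. by have := bop_lin F u 0 q; rewrite bop0r !addr0. Qed.

Lemma bopNr F u : F (- u) = - F u.
Proof. by apply/eqP; rewrite -addr_eq0 -bopDr addNr bop0r. Qed.

Lemma bop_bounded F : exists2 M : R, 0 <= M & forall u, hnorm (F u) <= M * hnorm u.
Proof.
case: (bopP F) => _ [M hM]; exists `|M| => // u.
by apply: le_trans (hM u) _; rewrite ler_wpM2r ?hnorm_ge0 ?ler_norm.
Qed.

Lemma BH_intro (f : H -> H) M : (forall u v q, f (u ** q + v) = f u ** q + f v) ->
  (forall u, hnorm (f u) <= M * hnorm u) -> BH f.
Proof. by move=> fl fM; split => //; exists M. Qed.

Lemma BH_add F G : BH (fun u => F u + G u).
Proof.
have [M _ hM] := bop_bounded F; have [N _ hN] := bop_bounded G.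
apply: (@BH_intro _ (M + N)) => [u v q|u] /=.
  by rewrite !bop_lin rscaleDl addrACA.
by apply: le_trans (hnormD _ _) _; rewrite mulrDl lerD.
Qed.

(** Real scalars are central; following [F] by right multiplication by a general quaternion need not
    be right linear. *)
Lemma BH_scale F a : BH (fun u => F u ** a%:q).
Proof.
have [M _ hM] := bop_bounded F; apply: (@BH_intro _ (`|a| * M)) => [u v q|u] /=.
  by rewrite bop_lin rscaleDl !rscaleM qmulZ.
by rewrite hnormZ -mulrA ler_wpM2l.
Qed.

Lemma BH_opp F : BH (fun u => - F u).
Proof.
have [M _ hM] := bop_bounded F; apply: (@BH_intro _ M) => [u v q|u] /=.
  by rewrite bop_lin opprD rscaleN.
by rewrite hnormN.
Qed.

Lemma BH_zero : BH (fun _ : H => 0).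
Proof.
apply: (@BH_intro _ 0) => [u v q|u]; first by rewrite rscale0 addr0.
by rewrite hnorm0 mul0r.
Qed.

Lemma BH_id : BH (@id H).
Proof. by apply: (@BH_intro _ 1) => [//|u]; rewrite mul1r. Qed.

Lemma BH_comp F G : BH (F \o G).
Proof.
have [M M0 hM] := bop_bounded F; have [N _ hN] := bop_bounded G.
apply: (@BH_intro _ (M * N)) => [u v q|u] /=; first by rewrite !bop_lin.
by apply: le_trans (hM _) _; rewrite -mulrA ler_wpM2l.
Qed.

Definition bop_add F G := Bop (BH_add F G).
Definition bop_opp F := Bop (BH_opp F).
Definition bop_zero := Bop BH_zero.
Definition bop_one := Bop BH_id.
Definition bop_mul F G := Bop (BH_comp F G).
Definition bop_scale a F := Bop (BH_scale F a).

Lemma bop_addA : associative bop_add.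
Proof. by move=> F G K; apply: bop_eq => u /=; rewrite addrA. Qed.
Lemma bop_addC : commutative bop_add.
Proof. by move=> F G; apply: bop_eq => u /=; rewrite addrC. Qed.
Lemma bop_add0 : left_id bop_zero bop_add.
Proof. by move=> F; apply: bop_eq => u /=; rewrite add0r. Qed.
Lemma bop_addN : left_inverse bop_zero bop_opp bop_add.
Proof. by move=> F; apply: bop_eq => u /=; rewrite addNr. Qed.

HB.instance Definition _ :=
  GRing.isZmodule.Build bop bop_addA bop_addC bop_add0 bop_addN.

Lemma bop_mulA : associative bop_mul.
Proof. by move=> F G K; apply: bop_eq. Qed.
Lemma bop_mul1l : left_id bop_one bop_mul.
Proof. by move=> F; apply: bop_eq. Qed.
Lemma bop_mul1r : right_id bop_one bop_mul.
Proof. by move=> F; apply: bop_eq. Qed.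
Lemma bop_mulDl : left_distributive bop_mul +%R.
Proof. by move=> F G K; apply: bop_eq. Qed.
Lemma bop_mulDr : right_distributive bop_mul +%R.
Proof. by move=> F G K; apply: bop_eq => u /=; rewrite bopDr. Qed.

(** [H] may be the zero space, where [1 = 0]; hence a possibly zero ring. *)
HB.instance Definition _ := GRing.Zmodule_isPzRing.Build bop
  bop_mulA bop_mul1l bop_mul1r bop_mulDl bop_mulDr.

Lemma bop_scaleA a b F : bop_scale a (bop_scale b F) = bop_scale (a * b) F.
Proof. by apply: bop_eq => u /=; rewrite rscaleM -qrealM mulrC. Qed.
Lemma bop_scale1 : left_id 1 bop_scale.
Proof. by move=> F; apply: bop_eq => u /=; rewrite rscale1. Qed.
Lemma bop_scaleDr : right_distributive bop_scale +%R.
Proof. by move=> a F G; apply: bop_eq => u /=; rewrite rscaleDl. Qed.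
Lemma bop_scaleDl F : {morph bop_scale^~ F : a b / a + b}.
Proof. by move=> a b; apply: bop_eq => u /=; rewrite qrealD rscaleDr. Qed.

HB.instance Definition _ := GRing.Zmodule_isLmodule.Build R bop
  bop_scaleA bop_scale1 bop_scaleDr bop_scaleDl.

Lemma bopD F G u : (F + G) u = F u + G u. Proof. by []. Qed.
Lemma bopN F u : (- F) u = - F u. Proof. by []. Qed.
Lemma bopB F G u : (F - G) u = F u - G u. Proof. by []. Qed.
Lemma bopM F G u : (F * G) u = F (G u). Proof. by []. Qed.
Lemma bop0 u : (0 : bop) u = 0. Proof. by []. Qed.
Lemma bop1 u : (1 : bop) u = u. Proof. by []. Qed.
Lemma bopZ a F u : (a *: F) u = F u ** a%:q. Proof. by []. Qed.
Definition bopE := (bopD, bopN, bopM, bop0, bop1, bopZ).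

Lemma bop_scaleAl a F G : a *: (F * G) = (a *: F) * G.
Proof. exact: bop_eq. Qed.
Lemma bop_scaleAr a F G : a *: (F * G) = F * (a *: G).
Proof. by apply: bop_eq => u; rewrite !bopE bopZr. Qed.

Definition opn F : R := opnorm F.

Lemma opn_set_sup F : has_sup [set hnorm (F u) | u in [set u | hnorm u <= 1]].
Proof.
split; first by exists (hnorm (F 0)), 0 => //=; rewrite hnorm0.
have [M M0 hM] := bop_bounded F; exists M => _ [u /= u1 <-].
by apply: le_trans (hM u) _; rewrite -[leRHS]mulr1 ler_wpM2l.
Qed.

Lemma opn_ge0 F : 0 <= opn F.
Proof.
have /(_ (hnorm (F 0))) := sup_upper_bound (opn_set_sup F); rewrite bop0r hnorm0.
by apply; exists 0; rewrite /= ?hnorm0// bop0r hnorm0.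
Qed.

Lemma opnP F u : hnorm (F u) <= opn F * hnorm u.
Proof.
have [->|u0] := eqVneq u 0; first by rewrite bop0r hnorm0 mulr0.
have nu : 0 < hnorm u by rewrite sqrtr_gt0; exact: rip_gt0.
have := sup_upper_bound (opn_set_sup F).
move=> /(_ (hnorm (F (u ** (hnorm u)^-1%:q)))).
rewrite bopZr hnormZ gtr0_norm ?invr_gt0// mulrC ler_pdivrMr//; apply.
exists (u ** (hnorm u)^-1%:q); last by rewrite bopZr hnormZ gtr0_norm ?invr_gt0// mulrC.
by rewrite /= hnormZ gtr0_norm ?invr_gt0// mulVf// gt_eqF.
Qed.

Lemma opn_le F c : 0 <= c -> (forall u, hnorm (F u) <= c * hnorm u) -> opn F <= c.
Proof.
move=> c0 hc; apply: ge_sup; first by case: (opn_set_sup F).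
by move=> _ [u /= u1 <-]; apply: le_trans (hc u) _; rewrite -[leRHS]mulr1 ler_wpM2l.
Qed.

Lemma opnD F G : opn (F + G) <= opn F + opn G.
Proof.
apply: opn_le => [|u]; first by rewrite addr_ge0 ?opn_ge0.
by rewrite mulrDl; apply: le_trans (hnormD _ _) _; rewrite lerD ?opnP.
Qed.

Lemma opnM F G : opn (F * G) <= opn F * opn G.
Proof.
apply: opn_le => [|u]; first by rewrite mulr_ge0 ?opn_ge0.
rewrite bopM; apply: le_trans (opnP F (G u)) _.
by rewrite -mulrA ler_wpM2l ?opn_ge0 ?opnP.
Qed.

Lemma opnZ_le a F : opn (a *: F) <= `|a| * opn F.
Proof.
apply: opn_le => [|u]; first by rewrite mulr_ge0 ?opn_ge0.
by rewrite bopZ hnormZ -mulrA ler_wpM2l ?opnP.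
Qed.

Lemma opnN F : opn (- F) = opn F.
Proof.
apply/eqP; rewrite eq_le; apply/andP; split; apply: opn_le; rewrite ?opn_ge0// => u.
  by rewrite bopN hnormN opnP.
by rewrite -hnormN -bopN opnP.
Qed.

Lemma opnB F G : opn (F - G) = opn (G - F).
Proof. by rewrite -opnN opprB. Qed.

Lemma opn0_eq F : opn F = 0 -> F = 0.
Proof.
move=> F0; apply: bop_eq => u; apply: hnorm_eq0; apply: le_anti.
by rewrite hnorm_ge0 andbT; have := opnP F u; rewrite F0 mul0r.
Qed.

(* In this form, limit arguments reduce to estimates with an explicit factor. *)
Lemma eq_of_opnB F G c : (forall e : R, 0 < e -> opn (F - G) <= e * c) -> F = G.
Proof.
move=> h; apply/eqP; rewrite -subr_eq0; apply/eqP/opn0_eq/le_anti.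
rewrite opn_ge0 andbT; apply/ler_addgt0Pr => e e0; rewrite add0r.
have c1 : 0 < `|c| + 1 by rewrite ltr_wpDl.
apply: le_trans (h (e / (`|c| + 1)) _) _; first by rewrite divr_gt0.
rewrite -mulrA ger_pMr// mulrC ler_pdivrMr// mul1r.
by apply: le_trans (ler_norm _) _; rewrite lerDl.
Qed.

Lemma rip_opn F u : `|rip (F u) u| <= opn F * rip u u.
Proof.
apply: le_trans (rip_le_hnorm _ _) _.
by rewrite -sqr_hnorm expr2 mulrA ler_wpM2r ?hnorm_ge0 ?opnP.
Qed.

Lemma hcauchy_cvg (x : nat -> H) :
  (forall e : R, 0 < e -> exists N, forall m n, (N <= m)%N -> (N <= n)%N ->
    hnorm (x m - x n) < e) ->
  exists l : H, forall e : R, 0 < e -> exists N, forall n, (N <= n)%N -> hnorm (x n - l) < e.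
Proof.
move=> xC; have [|l xl] := @inner_complete R H x.
  move=> e e0; have [N hN] := xC e e0.
  exists ([set n | (N <= n)%N], [set n | (N <= n)%N]).
    by split; exists N.
  by move=> [m n] /= [mN nN]; exact: hN.
exists l => e e0; move/cvgrPdist_lt: xl => /(_ e e0) [N _ hN]; exists N => n Nn.
by have := hN n Nn; rewrite sub0r normrN ger0_norm ?hnorm_ge0.
Qed.

End BoundedOperators.

(** * Riesz representation, adjoints and inverses *)

Section Variational.
Variables (R : realType) (H : quatHilbertType R).
Implicit Types (u v w x h : H) (q : quat R) (a b c : R) (W : set H).
Implicit Types F G K : bop H.

(** Closed subspaces of the real Hilbert space of [rip], hence the real scalars; closedness is
    sequential. *)
Definition rsubspace W :=
  [/\ W 0, (forall u v, W u -> W v -> W (u + v)),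
      (forall u a, W u -> W (u ** a%:q)) &
      (forall (x : nat -> H) l, (forall n, W (x n)) ->
        (forall e : R, 0 < e -> exists N, forall n, (N <= n)%N -> hnorm (x n - l) < e) ->
        W l)].

Definition sym F := forall u v, rip (F u) v = rip u (F v).

Lemma exists_inv_lt (e : R) : 0 < e -> exists N, forall n, (N <= n)%N -> n.+1%:R^-1 < e :> R.
Proof.
move=> e0; exists (Num.truncn e^-1) => n Nn.
rewrite invf_plt ?posrE// ?ltr0n//.
by apply: lt_le_trans (truncnS_gt _) _; rewrite ler_nat.
Qed.

(* Minimise the energy [(Av, v) - 2 phi v] over [W]: by the parallelogram law a
   minimising sequence is Cauchy, and its limit solves the Euler equation. *)
Lemma lax_milgram W F c M (phi : H -> R) : rsubspace W -> sym F -> 0 < c ->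
  (forall v, W v -> c * rip v v <= rip (F v) v) ->
  (forall u v, phi (u + v) = phi u + phi v) ->
  (forall u a, phi (u ** a%:q) = a * phi u) ->
  (forall u, `|phi u| <= M * hnorm u) ->
  exists2 u, W u & forall h, W h -> rip (F u) h = phi h.
Proof.
move=> [W0 WD WZ Wcl] symF c0 Fc phiD phiZ phiM.
have WB u v : W u -> W v -> W (u - v).
  move=> Wu Wv; apply: WD => //; rewrite (_ : - v = v ** (-1)%:q); first exact: WZ.
  by apply: rip_inj => w; rewrite !ripE mulN1r.
pose J v : R := rip (F v) v - 2 * phi v.
pose E := [set J v | v in W].
have Elb v : W v -> - (M ^+ 2 / c) <= J v.
  move=> Wv; have phiv := le_trans (ler_norm _) (phiM v).
  have := Fc _ Wv; rewrite -sqr_hnorm /J.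
  have : 0 <= c * (hnorm v - M / c) ^+ 2 by rewrite mulr_ge0 ?sqr_ge0// ltW.
  rewrite (_ : c * _ = c * hnorm v ^+ 2 - 2 * (M * hnorm v) + M ^+ 2 / c).
    by move: phiv; lra.
  by field; rewrite gt_eqF.
have Einf : has_inf E.
  split; first by exists (J 0), 0.
  by exists (- (M ^+ 2 / c)) => _ [v Wv <-]; exact: Elb.
pose m : R := inf E.
have mJ v : W v -> m <= J v.
  by move=> Wv; apply: ge_inf; [case: Einf | exists v].
have /choice[x xP] (n : nat) : exists v, W v /\ (J v < m + n.+1%:R^-1 :> R).
  have [|_ [v Wv <-] Jv] := @inf_adherent _ E n.+1%:R^-1 _ Einf.
    by rewrite invr_gt0.
  by exists v.
have JD u v a : J (u + v ** a%:q) =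
    J u + 2 * a * (rip (F u) v - phi v) + a ^+ 2 * rip (F v) v.
  rewrite /J bopDr bopZr !ripE phiD phiZ (symF v u) (ripC v (F u)); ring.
have Jpar u v : W u -> W v -> c * rip (u - v) (u - v) <= 2 * (J u + J v - 2 * m).
  move=> Wu Wv; have Wuv : W (v + (u - v) ** (2^-1)%:q) by apply/WD/WZ/WB.
  have := mJ _ Wuv; rewrite JD.
  have := JD v (u - v) 1; rewrite rscale1 addrC subrK.
  have := Fc _ (WB _ _ Wu Wv); lra.
have [e e0|l xl] := @hcauchy_cvg R H x.
  have [|N hN] := @exists_inv_lt (c * e ^+ 2 / 4).
    by rewrite divr_gt0// mulr_gt0// exprn_gt0.
  exists N => k n Nk Nn; rewrite -(@ltr_pXn2r _ 2) ?nnegrE ?hnorm_ge0 ?ltW//.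
  have [Wk Jk] := xP k; have [Wn Jn] := xP n.
  have : c * rip (x k - x n) (x k - x n) < c * e ^+ 2.
    move: (Jpar _ _ Wk Wn) (hN _ Nk) (hN _ Nn) Jk Jn.
    by move: k.+1%:R^-1 n.+1%:R^-1 => r s; lra.
  by rewrite ltr_pM2l// sqr_hnorm.
have Wl : W l by apply: (Wcl x) => // n; case: (xP n).
exists l => // h Wh.
(* [x n] minimises [J] up to [1 / (n + 1)], so the expansion of [J] along [h], with this slack as
   constant term, is a nonnegative quadratic in [t]; its discriminant bounds the defect in the Euler
   equation. *)
have euler n : (rip (F (x n)) h - phi h) ^+ 2 <= n.+1%:R^-1 * rip (F h) h.
  apply: discriminant_le => [|t].
    by apply: le_trans (Fc _ Wh); rewrite mulr_ge0 ?rip_ge0// ltW.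
  have [Wn Jn] := xP n.
  by have := mJ _ (WD _ _ Wn (WZ h t Wh)); rewrite JD; move: n.+1%:R^-1 Jn => r; lra.
have {}euler : (rip (F l) h - phi h) ^+ 2 = 0; last first.
  by apply/eqP; rewrite -subr_eq0 -sqrf_eq0 euler.
apply: le_anti; rewrite sqr_ge0 andbT; apply/ler_addgt0Pr => e e0; rewrite add0r.
pose B : R := rip (F h) h; pose D : R := opn F * hnorm h.
have B0 : 0 <= B by apply: le_trans (Fc _ Wh); rewrite mulr_ge0 ?rip_ge0// ltW.
have D0 : 0 <= D by rewrite mulr_ge0 ?opn_ge0 ?hnorm_ge0.
have den : 0 < 2 * (B + D ^+ 2 + 1).
  by rewrite mulr_gt0// ltr_wpDl// addr_ge0// sqr_ge0.
pose d : R := Num.min 1 (e / (2 * (B + D ^+ 2 + 1))).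
have d0 : 0 < d by rewrite lt_min ltr01 divr_gt0.
have d1 : d <= 1 by rewrite ge_min lexx.
have dlt : 2 * (B + D ^+ 2 + 1) * d <= e.
  by rewrite mulrC -ler_pdivlMr// ge_min lexx orbT.
have [N1 hN1] := exists_inv_lt d0; have [N2 hN2] := xl d d0.
pose n := maxn N1 N2.
have := euler n; have := hN1 n (leq_maxl _ _); have := hN2 n (leq_maxr _ _).
move=> xn nd; set y : R := rip (F (x n)) h - phi h => ey.
have -> : rip (F l) h - phi h = y - rip (F (x n - l)) h.
  by rewrite /y bopDr bopNr !ripE; ring.
set z : R := rip (F (x n - l)) h.
have zd : `|z| <= d * D.
  apply: le_trans (rip_le_hnorm _ _) _; rewrite /D mulrA (mulrC d).
  rewrite ler_wpM2r ?hnorm_ge0//; apply: le_trans (opnP _ _) _.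
  by rewrite ler_wpM2l ?opn_ge0 ?ltW.
have z2 : z ^+ 2 <= d * D ^+ 2.
  have dD2 : z ^+ 2 <= (d * D) ^+ 2.
    rewrite -[z ^+ 2]real_normK ?num_real// ler_pXn2r ?nnegrE ?normr_ge0//.
    by rewrite mulr_ge0// ltW.
  apply: le_trans dD2 _; rewrite exprMn ler_wpM2r ?sqr_ge0// expr2.
  by rewrite -[leRHS]mulr1 ler_wpM2l// ltW.
have y2 : y ^+ 2 <= d * B.
  by apply: le_trans ey _; rewrite ler_wpM2r// ltW.
have := sqr_ge0 (y + z); lra.
Qed.

Lemma rsubspaceT : rsubspace setT.
Proof. by []. Qed.

Lemma sym1 : sym 1. Proof. by []. Qed.

Lemma riesz M (phi : H -> R) :
  (forall u v, phi (u + v) = phi u + phi v) ->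
  (forall u a, phi (u ** a%:q) = a * phi u) ->
  (forall u, `|phi u| <= M * hnorm u) ->
  exists u, forall h, rip u h = phi h.
Proof.
move=> phiD phiZ phiM.
have [|u _ hu] := @lax_milgram setT 1 1 M phi rsubspaceT sym1 ltr01 _ phiD phiZ phiM.
  by move=> v _; rewrite mul1r.
by exists u => h; rewrite -hu.
Qed.

Lemma projection W w : rsubspace W ->
  exists2 u, W u & forall h, W h -> rip (w - u) h = 0.
Proof.
move=> sW; have [v _|u v|u a|u|u Wu hu] :=
    @lax_milgram W 1 1 (hnorm w) (rip w) sW sym1 ltr01.
- by rewrite mul1r.
- exact: ripDr.
- exact: ripZr.
- exact: rip_le_hnorm.
- by exists u => // h Wh; rewrite ripDl ripNl -hu// subrr.
Qed.

(** Riesz representation gives the map in the real Hilbert space; it is right linear over the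
    quaternions because [q] moves across [rip] as its conjugate and commutes with [F]. *)
Lemma adj_exists F : exists G, forall u v, rip (G u) v = rip u (F v).
Proof.
have /choice[g gP] u : exists u', forall h, rip u' h = rip u (F h).
  apply: (@riesz (hnorm u * opn F)) => [v w|v a|v].
  - by rewrite bopDr ripDr.
  - by rewrite bopZr ripZr.
  - apply: le_trans (rip_le_hnorm _ _) _.
    by rewrite -mulrA ler_wpM2l ?hnorm_ge0// opnP.
suff hg : BH g by exists (Bop hg).
apply: (@BH_intro _ _ _ (opn F)) => [u v q|u].
  apply: rip_inj => w; rewrite gP !ripDl -{2}(qconjK q) -ripMr !gP.
  by rewrite bopZr ripMr qconjK.
have [->|u0] := eqVneq (hnorm (g u)) 0; first by rewrite mulr_ge0 ?opn_ge0 ?hnorm_ge0.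
have n0 : 0 < hnorm (g u) by rewrite lt_neqAle eq_sym u0 hnorm_ge0.
rewrite -(ler_pM2r n0) -expr2 sqr_hnorm gP mulrAC mulrC.
apply: le_trans (ler_rip _ _) _; rewrite ler_wpM2l ?hnorm_ge0//.
exact: opnP.
Qed.

Definition adj F : bop H := projT1 (cid (adj_exists F)).

Lemma adjP F u v : rip (adj F u) v = rip u (F v).
Proof. by rewrite /adj; case: cid. Qed.

Lemma adjPr F u v : rip u (adj F v) = rip (F u) v.
Proof. by rewrite ripC adjP ripC. Qed.

Lemma adj_uniq F G : (forall u v, rip (G u) v = rip u (F v)) -> G = adj F.
Proof. by move=> h; apply: bop_eq => u; apply: rip_inj => v; rewrite h adjP. Qed.

Lemma adjM F G : adj (F * G) = adj G * adj F.
Proof. by symmetry; apply: adj_uniq => u v; rewrite !bopM !adjP. Qed.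

Lemma adjK F : adj (adj F) = F.
Proof. by symmetry; apply: adj_uniq => u v; rewrite adjPr. Qed.

Lemma sym_adj F : sym F -> adj F = F.
Proof. by move=> sF; symmetry; apply: adj_uniq. Qed.

(** Right linearity of [F] upgrades the identity for [rip] to one for [inner], and uniqueness of the
    adjoint for [rip] identifies the chosen operator. *)
Lemma adjointE F : adjoint F = adj F.
Proof.
have inner_adj u v : inner (adj F u) v = inner u (F v).
  by apply: rip_inner => q; rewrite adjP bopZr.
rewrite /adjoint; case: xgetP => [S -> [BS hS]|/(_ (adj F)) []]; last first.
  by split=> //; exact: bopP.
by rewrite -(@adj_uniq F (Bop BS))// => u v; rewrite !rip_def hS.
Qed.

Definition invertible F := exists2 G, G * F = 1 & F * G = 1.

(** [lax_milgram] on the whole space gives surjectivity; the lower bound gives injectivity and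
    bounds the inverse by [c^-1]. *)
Lemma coercive_invertible F c : sym F -> 0 < c ->
  (forall u, c * rip u u <= rip (F u) u) -> invertible F.
Proof.
move=> sF c0 Fc.
have nF u : c * hnorm u <= hnorm (F u).
  have [->|u0] := eqVneq (hnorm u) 0; first by rewrite mulr0 hnorm_ge0.
  have n0 : 0 < hnorm u by rewrite lt_neqAle eq_sym u0 hnorm_ge0.
  rewrite -(ler_pM2r n0) -mulrA -expr2 sqr_hnorm.
  exact: le_trans (Fc u) (ler_rip _ _).
have Finj u v : F u = F v -> u = v.
  move=> Fuv; apply/eqP; rewrite -subr_eq0; apply/eqP/hnorm_eq0/le_anti.
  rewrite hnorm_ge0 andbT -(pmulr_rle0 _ c0).
  by apply: le_trans (nF _) _; rewrite bopDr bopNr Fuv subrr hnorm0.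
have /choice[g gP] w : exists u, F u = w.
  have [v _|u v|u a|u|u _ hu] :=
    @lax_milgram setT F c (hnorm w) (rip w) rsubspaceT sF c0.
  - exact: Fc.
  - exact: ripDr.
  - exact: ripZr.
  - exact: rip_le_hnorm.
  - by exists u; apply: rip_inj => h; exact: hu.
have hg : BH g.
  apply: (@BH_intro _ _ _ c^-1) => [u v q|u].
    by apply: Finj; rewrite bop_lin !gP.
  by rewrite mulrC ler_pdivlMr// mulrC; apply: le_trans (nF _) _; rewrite gP.
by exists (Bop hg); apply: bop_eq => u; [apply: Finj|]; rewrite bopM gP.
Qed.

Lemma invertibleM F G : invertible F -> invertible G -> invertible (F * G).
Proof.
move=> [F' F'F FF'] [G' G'G GG']; exists (G' * F').
  by rewrite mulrA -(mulrA G') F'F mulr1.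
by rewrite mulrA -(mulrA F) GG' mulr1.
Qed.

End Variational.

(** * Polynomial calculus and spectrum *)

Section RealFactors.
Variable R : rcfType.
Implicit Types p q : {poly R}.

(** Take a complex root. If it is not real, it also kills the quadratic, so the remainder of [p]
    modulo the quadratic has degree at most one and a non-real root; it vanishes. *)
Lemma real_poly_factor p : size p != 1%N ->
  (exists x, root p x) \/
  (exists a b : R, b != 0 /\ ('X - a%:P) ^+ 2 + (b ^+ 2)%:P %| p).
Proof.
move=> sp; pose toC := real_complex R.
have /closed_rootP[z rz] : size (map_poly toC p) != 1%N by rewrite size_map_poly.
case: z rz => a b rz; have [b0|b0] := eqVneq b 0.
  by left; exists a; rewrite b0 in rz; rewrite -(fmorph_root toC).
right; exists a, b; split => //; set q : {poly R} := _ + _%:P.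
have zE : Complex a b - toC a = Complex 0 b by apply/eqP; rewrite eq_complex /= subrr subr0 !eqxx.
have qz : (map_poly toC q).[Complex a b] = 0.
  rewrite rmorphD rmorphXn rmorphB /= map_polyX !map_polyC !hornerE /= zE.
  by apply/eqP; rewrite eq_complex /=; apply/andP; split; apply/eqP; ring.
have sq : size q = 3%N.
  by rewrite size_polyDl size_exp_XsubC// (leq_ltn_trans (size_polyC_leq1 _)).
rewrite /dvdp; set r : {poly R} := p %% q.
have q0 : q != 0 by rewrite -size_poly_eq0 sq.
have sr : (size r <= 2)%N by rewrite -ltnS -sq ltn_modp.
have rE : r = r`_1 *: 'X + (r`_0)%:P.
  apply/polyP => -[|[|i]]; rewrite !(coefD, coefZ, coefX, coefC) /= ?mulr0 ?mulr1 ?add0r ?addr0//.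
  by rewrite nth_default// (leq_trans sr).
have : (map_poly toC r).[Complex a b] = 0.
  have := rz; rewrite rootE {1}(divp_eq p q) rmorphD rmorphM hornerD hornerM qz.
  by rewrite mulr0 add0r => /eqP.
rewrite rE rmorphD /= map_polyZ map_polyX map_polyC !hornerE /= => /eqP.
rewrite eq_complex /= => /andP[/eqP r0 /eqP r1].
have {}r1 : r`_1 = 0.
  by move: r1; rewrite mul0r !addr0 => /eqP; rewrite mulf_eq0 (negPf b0) orbF => /eqP.
by move: r0; rewrite r1 !mul0r subr0 add0r => ->; rewrite scale0r add0r.
Qed.

End RealFactors.

Section PolynomialCalculus.
Variables (R : realType) (H : quatHilbertType R).
Implicit Types (u v w x : H) (a b c s : R) (p q : {poly R}).
Implicit Types F G K : bop H.

Local Notation one := (1 : bop H).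

Definition peval F p := \sum_(i < size p) p`_i *: F ^+ i.

Lemma peval_wide F p n : (size p <= n)%N -> peval F p = \sum_(i < n) p`_i *: F ^+ i.
Proof.
move=> pn; rewrite /peval (big_ord_widen n (fun i => p`_i *: F ^+ i))// big_mkcond.
by apply: eq_bigr => i _; case: ltnP => // pi; rewrite nth_default// scale0r.
Qed.

Lemma pevalD F p q : peval F (p + q) = peval F p + peval F q.
Proof.
rewrite (peval_wide F (size_polyD p q)) (peval_wide F (leq_maxl (size p) (size q))).
rewrite (peval_wide F (leq_maxr (size p) (size q))).
by under eq_bigr do rewrite coefD scalerDl; rewrite big_split.
Qed.

Lemma pevalZ F a p : peval F (a *: p) = a *: peval F p.
Proof.
rewrite (peval_wide F (size_scale_leq a p)) /peval scaler_sumr.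
by apply: eq_bigr => i _; rewrite coefZ scalerA.
Qed.

Lemma peval0 F : peval F 0 = 0.
Proof. by rewrite -(scale0r 0) pevalZ scale0r. Qed.

Lemma pevalN F p : peval F (- p) = - peval F p.
Proof. by rewrite -scaleN1r pevalZ scaleN1r. Qed.

Lemma pevalB F p q : peval F (p - q) = peval F p - peval F q.
Proof. by rewrite pevalD pevalN. Qed.

Lemma pevalC F a : peval F a%:P = a *: one.
Proof.
by rewrite (peval_wide F (size_polyC_leq1 a)) big_ord1 coefC eqxx expr0.
Qed.

Lemma pevalMX F p : peval F (p * 'X) = peval F p * F.
Proof.
have sp : (size (p * 'X)%R <= (size p).+1)%N.
  by apply: leq_trans (size_polyMleq _ _) _; rewrite size_polyX addn2.
rewrite (peval_wide F sp) big_ord_recl coefMX eqxx scale0r add0r /peval mulr_suml.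
by apply: eq_bigr => i _; rewrite coefMX /= exprSr bop_scaleAl.
Qed.

Lemma peval_comm F p : peval F p * F = F * peval F p.
Proof.
rewrite /peval mulr_suml mulr_sumr; apply: eq_bigr => i _.
by rewrite -bop_scaleAl -bop_scaleAr -exprS -exprSr.
Qed.

Lemma pevalM F p q : peval F (p * q) = peval F p * peval F q.
Proof.
elim/poly_ind: q => [|q c IH]; first by rewrite mulr0 peval0 mulr0.
rewrite mulrDr mulrA !pevalD !pevalMX IH mulrDr mulrA.
by rewrite mulrC mul_polyC pevalZ pevalC -bop_scaleAr mulr1.
Qed.

Lemma pevalX F : peval F 'X = F.
Proof. by rewrite -['X]mul1r pevalMX -polyC1 pevalC scale1r mul1r. Qed.

Definition psd F := sym F /\ forall u, 0 <= rip (F u) u.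
Definition ople F G := forall u, rip (F u) u <= rip (G u) u.

Lemma symD F G : sym F -> sym G -> sym (F + G).
Proof. by move=> sF sG u v; rewrite !bopD !ripE sF sG. Qed.

Lemma symZ a F : sym F -> sym (a *: F).
Proof. by move=> sF u v; rewrite !bopZ !ripE sF. Qed.

Lemma symN F : sym F -> sym (- F).
Proof. by move=> sF; rewrite -scaleN1r; exact: symZ. Qed.

Lemma symM F G : sym F -> sym G -> F * G = G * F -> sym (F * G).
Proof. by move=> sF sG FG u v; rewrite {2}FG !bopM sF sG. Qed.

Lemma symX F n : sym F -> sym (F ^+ n).
Proof.
move=> sF; elim: n => [|n IH]; first exact: sym1.
by rewrite exprS; apply: symM => //; rewrite -exprSr -exprS.
Qed.

Lemma sym_peval F p : sym F -> sym (peval F p).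
Proof.
move=> sF; rewrite /peval; elim/big_ind: _ => [u v||i _].
- by rewrite !bop0 rip0l ripr0.
- exact: symD.
- exact/symZ/symX.
Qed.

Lemma invertibleN F : invertible (- F) -> invertible F.
Proof. by move=> [G GF FG]; exists (- G); [rewrite mulNr -mulrN | rewrite mulrN -mulNr]. Qed.

Lemma invertible_sqr F : invertible (F * F) -> invertible F.
Proof.
move=> [G GF FG]; exists (G * F); first by rewrite -mulrA.
have -> : G * F = F * G.
  by rewrite -[LHS]mulr1 -FG !mulrA -(mulrA G F F) GF mul1r.
by rewrite mulrA.
Qed.

Lemma invertibleZ a : a != 0 -> invertible (a *: one).
Proof.
move=> a0; exists (a^-1 *: one); rewrite -bop_scaleAl mul1r scalerA ?mulVf ?mulfV ?scale1r//.
Qed.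

Lemma DeltaE F s : Delta s%:q F = (F - s *: one) * (F - s *: one).
Proof.
apply/funext => u; rewrite /Delta qconj_real -qrealD.
rewrite !bopE bopDr bopNr bopZr; apply: rip_inj => w.
rewrite !ripE /qnorm2 /= expr0n /= !addr0; ring.
Qed.

(** At a real point [Delta] is the square of [F - s], and an operator is invertible as soon as its
    square is. *)
Lemma real_sigmaP F s : real_sigma_S F s <-> ~ invertible (F - s *: one).
Proof.
rewrite /real_sigma_S /sigma_S /= DeltaE; split; apply: contra_not.
  move=> iF; have [G GF FG] := invertibleM iF iF.
  exists G; split; first exact: bopP.
    by rewrite -[LHS]/(bfun (G * _)) GF.
  by rewrite -[LHS]/(bfun (_ * G)) FG.
move=> [S [BS SF FS]]; apply: invertible_sqr; exists (Bop BS).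
  by apply: bop_eq => u; rewrite bopM; have /(congr1 (@^~ u)) := SF.
by apply: bop_eq => u; rewrite bopM; have /(congr1 (@^~ u)) := FS.
Qed.

Lemma sigma_ge F s m : sym F -> (forall u, m * rip u u <= rip (F u) u) ->
  real_sigma_S F s -> m <= s.
Proof.
move=> sF Fm /real_sigmaP; apply: contra_notP => /negP; rewrite -ltNge => s0.
apply: (@coercive_invertible _ _ _ (m - s)); rewrite ?subr_gt0//.
  exact/symD/symN/symZ/sym1.
by move=> u; rewrite !bopE !ripE; have := Fm u; lra.
Qed.

Lemma sigma_ge0 F s : psd F -> real_sigma_S F s -> 0 <= s.
Proof. by move=> [sF F0]; apply: sigma_ge => // u; rewrite mul0r. Qed.

Lemma sigma_le F s M : sym F -> (forall u, rip (F u) u <= M * rip u u) ->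
  real_sigma_S F s -> s <= M.
Proof.
move=> sF FM /real_sigmaP; apply: contra_notP => /negP; rewrite -ltNge => s0.
apply/invertibleN/(@coercive_invertible _ _ _ (s - M)); rewrite ?subr_gt0//.
  exact/symN/symD/symN/symZ/sym1.
by move=> u; rewrite !bopE !ripE; have := FM u; lra.
Qed.

Lemma ler_rip_opn F u : rip (F u) u <= opn F * rip u u.
Proof. exact: le_trans (ler_norm _) (rip_opn F u). Qed.

Lemma sigma_le_opn F s : sym F -> real_sigma_S F s -> s <= opn F.
Proof. by move=> sF; apply: sigma_le => // u; exact: ler_rip_opn. Qed.

Lemma invertible_bounded_below F : invertible F ->
  exists2 c, 0 < c & forall u, c * hnorm u <= hnorm (F u).
Proof.
move=> [G GF _]; exists (opn G + 1)^-1 => [|u]; first by rewrite invr_gt0 ltr_wpDl ?opn_ge0.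
rewrite mulrC ler_pdivrMr ?ltr_wpDl ?opn_ge0//.
rewrite -{1}[u]bop1 -GF bopM; apply: le_trans (opnP _ _) _.
by rewrite mulrC ler_wpM2l ?hnorm_ge0// lerDl.
Qed.

(* [F F >= c^2 > 0], and [F F] invertible forces [F] invertible. *)
Lemma bounded_below_invertible F c : sym F -> 0 < c ->
  (forall u, c * hnorm u <= hnorm (F u)) -> invertible F.
Proof.
move=> sF c0 Fc; apply: invertible_sqr.
apply: (@coercive_invertible _ _ _ (c ^+ 2)); rewrite ?exprn_gt0//.
  exact: symM.
move=> u; rewrite bopM sF -!sqr_hnorm -exprMn ler_pXn2r// nnegrE ?hnorm_ge0//.
by rewrite mulr_ge0 ?hnorm_ge0// ltW.
Qed.

(** A lower bound [c] for [F - s] survives as [c / 2] when [s] moves by less than [c / 2]. *)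
Lemma sigma_closed F : sym F -> closed (real_sigma_S F).
Proof.
move=> sF; rewrite -[X in closed X]setCK; apply: open_closedC.
rewrite openE => s /= /real_sigmaP/contrapT/invertible_bounded_below[c c0 Fc].
exists (c / 2) => /=; first by rewrite divr_gt0.
move=> t /= st /real_sigmaP; apply.
apply: (@bounded_below_invertible _ (c / 2)); rewrite ?divr_gt0//.
  exact/symD/symN/symZ/sym1.
move=> u; have -> : (F - t *: one) u = (F - s *: one) u - u ** (t - s)%:q.
  by apply: rip_inj => w; rewrite !bopE !ripE; ring.
have := hnormD ((F - s *: one) u - u ** (t - s)%:q) (u ** (t - s)%:q).
rewrite subrK hnormZ distrC; have := Fc u.
have : `|s - t| * hnorm u <= c / 2 * hnorm u by rewrite ler_wpM2r ?hnorm_ge0// ltW.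
lra.
Qed.

(** Induction on the degree. Linear factors are invertible by the assumption on roots; a quadratic
    factor is at least [b ^+ 2], hence coercive. *)
Lemma peval_invertible F p : sym F -> p != 0 ->
  (forall s, real_sigma_S F s -> ~~ root p s) -> invertible (peval F p).
Proof.
move=> sF; have [n] := ubnP (size p); elim: n p => // n IH p spn p0 pK.
have [/eqP/size_poly1P[c c0 ->]|sp] := eqVneq (size p) 1%N.
  by rewrite pevalC; exact: invertibleZ.
have step q r : p = r * q -> (1 < size q)%N -> invertible (peval F q) -> invertible (peval F p).
  move=> pE sq iq; rewrite pE pevalM; apply: invertibleM => //.
  have r0 : r != 0 by apply: contra_neq p0 => r0; rewrite pE r0 mul0r.
  have q0 : q != 0 by rewrite -size_poly_gt0; apply: leq_trans sq.
  apply: IH => //.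
    rewrite -ltnS; apply: leq_ltn_trans spn; rewrite pE size_mul//.
    by case: (size q) sq => [|[|k]]// _; rewrite !addnS /= ltnS leq_addr.
  by move=> s /pK; apply: contra; rewrite pE rootM => ->.
have [[x px]|[a [b [b0 /dvdpP[r pE]]]]] := real_poly_factor sp.
  have /factor_theorem[r pE] := px.
  apply: step pE _ _; first by rewrite size_XsubC.
  rewrite pevalB pevalX pevalC; apply: contrapT => /real_sigmaP/pK.
  by rewrite px.
apply: step pE _ _.
  by rewrite size_polyDl size_exp_XsubC// (leq_ltn_trans (size_polyC_leq1 _)).
apply: (@coercive_invertible _ _ _ (b ^+ 2)); first exact: sym_peval.
  by rewrite lt_neqAle sqr_ge0 eq_sym sqrf_eq0 b0.
move=> u; have sFa : sym (F - a *: one) by exact/symD/symN/symZ/sym1.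
rewrite pevalD expr2 pevalM !pevalB pevalX !pevalC bopD bopM ripDl sFa.
by rewrite bopZ bop1 ripZl lerDr rip_ge0.
Qed.

(** Cauchy-Schwarz for the form of [F], at the vectors [u] and [F u]. *)
Lemma psd_sqr_le F u : psd F -> rip (F u) (F u) <= opn F * rip (F u) u.
Proof.
move=> [sF F0].
have cs : rip (F u) (F u) ^+ 2 <= rip (F u) u * rip (F (F u)) (F u).
  apply: discriminant_le => [|t]; first exact: F0.
  have := F0 (u + F u ** t%:q); rewrite bopDr bopZr !ripE (sF (F u) u).
  by move=> /le_trans; apply; rewrite le_eqVlt; apply/orP; left; apply/eqP; ring.
have [->|Fu0] := eqVneq (rip (F u) (F u)) 0; first by rewrite mulr_ge0 ?opn_ge0.
have Fu_gt0 : 0 < rip (F u) (F u) by rewrite lt_neqAle eq_sym Fu0 rip_ge0.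
rewrite -(ler_pM2r Fu_gt0) -expr2; apply: le_trans cs _.
by rewrite [leRHS]mulrAC mulrC ler_wpM2r ?F0 ?ler_rip_opn.
Qed.

(* If [m], the infimum of the form of [G], were negative, [G - m >= 0] would be
   invertible, hence bounded below, contradicting the choice of [m]. *)
Lemma psd_of_invertible G : sym G ->
  (forall m, m < 0 -> invertible (G - m *: one)) -> psd G.
Proof.
move=> sG Gi; split => // u; rewrite leNgt; apply/negP => Gu.
pose E : set R := [set m | forall v, m * rip v v <= rip (G v) v].
have u0 : u != 0 by apply: contraTneq Gu => ->; rewrite bop0r rip0l ltxx.
have Esup : has_sup E.
  split.
    exists (- opn G) => v /=; have := rip_opn G v; rewrite ler_norml mulNr.
    by case/andP.
  exists (rip (G u) u / rip u u) => m /(_ u).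
  by rewrite ler_pdivlMr ?rip_gt0.
pose m : R := sup E.
have mE v : m * rip v v <= rip (G v) v.
  have [->|v0] := eqVneq v 0; first by rewrite bop0r !rip0l mulr0.
  rewrite -ler_pdivlMr ?rip_gt0//; apply: ge_sup; first by case: Esup.
  by move=> y /(_ v); rewrite ler_pdivlMr ?rip_gt0.
have m0 : m < 0 by rewrite -(pmulr_llt0 _ (rip_gt0 u0)); exact: le_lt_trans (mE u) Gu.
have [c c0 hc] := invertible_bounded_below (Gi m m0).
have sN : sym (G - m *: one) by exact/symD/symN/symZ/sym1.
have pN : psd (G - m *: one).
  by split => // v; rewrite !bopE !ripE; have := mE v; lra.
(* For [N = G - m], the squared norm of [N v] is at least [c ^+ 2 * rip v v] and, by [psd_sqr_le],
   at most [opn N * rip (N v) v]. So [m] could be raised by [e]; the [+ 1] keeps the denominator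
   positive. *)
pose e : R := c ^+ 2 / (opn (G - m *: one) + 1).
have N1 : 0 < opn (G - m *: one) + 1 by rewrite ltr_wpDl ?opn_ge0.
have e0 : 0 < e by rewrite divr_gt0// exprn_gt0.
have : m + e <= m.
  apply: sup_upper_bound => // v.
  suff : e * rip v v <= rip ((G - m *: one) v) v.
    by rewrite !bopE !ripE; lra.
  rewrite /e mulrAC ler_pdivrMr// mulrC [leRHS]mulrC.
  apply: le_trans (_ : _ <= rip ((G - m *: one) v) ((G - m *: one) v)) _.
    rewrite -!sqr_hnorm mulrC -exprMn ler_pXn2r ?nnegrE ?hnorm_ge0//.
    by rewrite mulr_ge0 ?hnorm_ge0// ltW.
  apply: le_trans (psd_sqr_le _ pN) _; rewrite ler_wpM2r ?lerDl//.
  by case: pN.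
by rewrite gerDl leNgt e0.
Qed.

(** Otherwise [F - (opn F + 1)] would be positive, although its form is at most [- rip u u]. *)
Lemma sigma_empty F : sym F -> (forall s, ~ real_sigma_S F s) -> forall u, u = 0.
Proof.
move=> sF K0 u; apply: rip_eq0; apply: le_anti; rewrite rip_ge0 andbT.
have [|m _|_ /(_ u)] := @psd_of_invertible (F - (opn F + 1) *: one).
- exact/symD/symN/symZ/sym1.
- by rewrite -addrA -opprD -scalerDl; apply: contrapT => /real_sigmaP; exact: K0.
- by rewrite !bopE !ripE; have := ler_rip_opn F u; lra.
Qed.

Lemma peval_psd F p : sym F -> (forall s, real_sigma_S F s -> 0 <= p.[s]) ->
  psd (peval F p).
Proof.
(* [peval_invertible] needs [p - m%:P] to be nonzero. A point of the spectrum, where it is positive,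
   shows this, so an empty spectrum is treated apart. *)
move=> sF pK; have [K0|[s0 Ks0]] : (forall s, ~ real_sigma_S F s) \/ exists s, real_sigma_S F s.
- by have [?|/forallNP ?] := pselect (exists s, real_sigma_S F s); [right|left].
- by split=> u; [exact: sym_peval | rewrite (sigma_empty sF K0 u) ripr0].
apply: psd_of_invertible; first exact: sym_peval.
move=> m m0; rewrite -(pevalC F) -pevalB.
have pmN s : real_sigma_S F s -> ~~ root (p - m%:P) s.
  move=> /pK ps; rewrite rootE hornerD hornerN hornerC subr_eq0 gt_eqF//.
  exact: lt_le_trans m0 ps.
apply: peval_invertible => //.
by apply: contraNneq (pmN _ Ks0) => ->; rewrite root0.
Qed.

End PolynomialCalculus.

(** * Continuous functional calculus *)

(* [ring] does not apply to the noncommutative ring [bop H]; linear identities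
   are checked weakly, after distributing. *)
Ltac bop_ring :=
  apply: bop_eq => ?; apply: rip_inj => ?;
  rewrite !(bopE, bopDr, bopNr, bopZr) !ripE; ring.

Section Calculus.
Variables (R : realType) (H : quatHilbertType R).
Implicit Types (u v w x : H) (a b c s e : R) (p q : {poly R}) (f g : R -> R).
Implicit Types F G K : bop H.

Local Notation one := (1 : bop H).
Local Notation sigma := real_sigma_S.

Lemma opn_le_psd G c : sym G -> 0 <= c -> psd ((c ^+ 2) *: one - G * G) -> opn G <= c.
Proof.
move=> sG c0 [_ cG]; apply: opn_le => // u.
rewrite -(ler_pXn2r (n := 2)) ?nnegrE ?hnorm_ge0 ?mulr_ge0 ?hnorm_ge0//.
have := cG u; rewrite exprMn !sqr_hnorm !bopE !ripE sG subr_ge0.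
by [].
Qed.

(** The bound by the sup norm on the spectrum comes from positivity of [c ^+ 2 - p ^+ 2]; it is what
    allows the polynomial calculus to be completed. *)
Lemma peval_opn_le F p c : sym F -> 0 <= c ->
  (forall s, sigma F s -> `|p.[s]| <= c) -> opn (peval F p) <= c.
Proof.
move=> sF c0 pc; apply: opn_le_psd => //; first exact: sym_peval.
rewrite -pevalM -(pevalC F) -pevalB; apply: peval_psd => // s /pc ps.
rewrite !hornerE -expr2 subr_ge0 -[p.[s] ^+ 2]real_normK ?num_real//.
by rewrite ler_pXn2r ?nnegrE.
Qed.

(* [fcr F f G]: the operator [G] is the value at [F] of the function [f]. *)
Definition fcr F f G := forall e : R, 0 < e ->
  exists2 p, (forall s, sigma F s -> `|p.[s] - f s| <= e) & opn (G - peval F p) <= e.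

Lemma fcr_dist F f g G K c : sym F -> 0 <= c -> fcr F f G -> fcr F g K ->
  (forall s, sigma F s -> `|f s - g s| <= c) -> opn (G - K) <= c.
Proof.
move=> sF c0 fG gK fg; apply/ler_addgt0Pr => e e0.
have e4 : 0 < e / 4 by rewrite divr_gt0.
have [p pf pG] := fG _ e4; have [q qg qK] := gK _ e4.
have -> : G - K = (G - peval F p) + (peval F (p - q) - (K - peval F q)).
  by rewrite pevalB; bop_ring.
have pq : opn (peval F (p - q)) <= c + e / 2.
  apply: peval_opn_le => [//||s Ks]; first by rewrite addr_ge0// divr_ge0// ltW.
  rewrite !hornerE.
  have -> : p.[s] - q.[s] = (p.[s] - f s) + ((f s - g s) - (q.[s] - g s)) by ring.
  have := ler_normD (p.[s] - f s) ((f s - g s) - (q.[s] - g s)).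
  have := ler_normB (f s - g s) (q.[s] - g s).
  by move: (pf _ Ks) (qg _ Ks) (fg _ Ks); lra.
have := opnD (G - peval F p) (peval F (p - q) - (K - peval F q)).
have := opnD (peval F (p - q)) (- (K - peval F q)); rewrite opnN; lra.
Qed.

Lemma fcr_unique F f g G K : sym F -> fcr F f G -> fcr F g K ->
  (forall s, sigma F s -> f s = g s) -> G = K.
Proof.
move=> sF fG gK fg; apply: (@eq_of_opnB _ _ _ _ 1) => e e0; rewrite mulr1.
by apply: fcr_dist fG gK _; rewrite ?(ltW e0)// => s /fg ->; rewrite subrr normr0 ltW.
Qed.

Lemma fcr_poly F p : fcr F (horner p) (peval F p).
Proof.
move=> e e0; exists p => [s _|]; first by rewrite subrr normr0 ltW.
rewrite subrr; apply: opn_le => [|u]; first exact: ltW.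
by rewrite bop0 hnorm0 mulr_ge0 ?hnorm_ge0 ?ltW.
Qed.

Lemma fcr_ext F f g G : fcr F f G -> (forall s, sigma F s -> f s = g s) -> fcr F g G.
Proof.
by move=> fG fg e e0; have [p pf pG] := fG e e0; exists p => // s Ks; rewrite -fg// pf.
Qed.

Lemma fcr_add F f g G K : fcr F f G -> fcr F g K -> fcr F (fun s => f s + g s) (G + K).
Proof.
move=> fG gK e e0; have e2 : 0 < e / 2 by rewrite divr_gt0.
have [p pf pG] := fG _ e2; have [q qg qK] := gK _ e2.
exists (p + q) => [s Ks|].
  rewrite !hornerE opprD addrACA; apply: le_trans (ler_normD _ _) _.
  by have := pf _ Ks; have := qg _ Ks; lra.
rewrite pevalD opprD addrACA; apply: le_trans (opnD _ _) _; lra.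
Qed.

Lemma fcr_scale F f G a : fcr F f G -> fcr F (fun s => a * f s) (a *: G).
Proof.
move=> fG e e0; have e2 : 0 < e / (`|a| + 1) by rewrite divr_gt0// ltr_wpDl.
have ae : `|a| * (e / (`|a| + 1)) <= e.
  by rewrite mulrCA ger_pMr// ler_pdivrMr ?ltr_wpDl// mul1r lerDl.
have [p pf pG] := fG _ e2; exists (a *: p) => [s Ks|].
  rewrite hornerZ -mulrBr normrM; apply: le_trans ae.
  by rewrite ler_wpM2l// pf.
rewrite pevalZ -scalerBr; apply: le_trans (opnZ_le _ _) _; apply: le_trans ae.
by rewrite ler_wpM2l.
Qed.

Lemma fcr_bounded F f G : sym F -> fcr F f G ->
  exists2 B, 0 <= B & forall s, 0 <= s -> sigma F s -> `|f s| <= B.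
Proof.
move=> sF fG; have [p pf pG] := fG 1 ltr01.
have [B B0 hB] := continuous_bounded_itv (opn F) (@continuous_horner R p).
exists (B + 1) => [|s s0 Ks]; first by rewrite addr_ge0.
have := ler_normB p.[s] (p.[s] - f s); rewrite subKr.
have := hB s; rewrite s0 sigma_le_opn// => /(_ isT).
have := pf _ Ks; lra.
Qed.

Lemma fcr_mul F f g G K : psd F -> fcr F f G -> fcr F g K ->
  fcr F (fun s => f s * g s) (G * K).
Proof.
move=> pF; have sF := pF.1; move=> fG gK e e0.
have [B B0 fB] := fcr_bounded sF fG; have [C C0 gC] := fcr_bounded sF gK.
(* Large enough for the errors of both products, on the spectrum and in operator norm; [d <= 1]
   turns the quadratic error term into a linear one. *)
pose N : R := B + C + opn G + opn K + 2.
have N0 : 0 < N by rewrite ltr_wpDl// !addr_ge0 ?opn_ge0.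
pose d : R := Num.min 1 (e / N).
have d0 : 0 < d by rewrite lt_min ltr01 divr_gt0.
have d1 : d <= 1 by rewrite ge_min lexx.
have dN : d * N <= e by rewrite -ler_pdivlMr// ge_min lexx orbT.
have dd : d * d <= d by rewrite -[leRHS]mulr1 ler_wpM2l// ltW.
have [p pf pG] := fG _ d0; have [q qg qK] := gK _ d0.
have dB : 0 <= d * B by rewrite mulr_ge0// ltW.
have dC : 0 <= d * C by rewrite mulr_ge0// ltW.
have dG : 0 <= d * opn G by rewrite mulr_ge0 ?opn_ge0// ltW.
have dK : 0 <= d * opn K by rewrite mulr_ge0 ?opn_ge0// ltW.
exists (p * q) => [s Ks|].
  have {}fB := fB s (sigma_ge0 pF Ks) Ks; have {}gC := gC s (sigma_ge0 pF Ks) Ks.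
  have {}pf := pf _ Ks; have {}qg := qg _ Ks.
  rewrite hornerM; have -> : p.[s] * q.[s] - f s * g s =
    (p.[s] - f s) * (q.[s] - g s) + (f s * (q.[s] - g s) + (p.[s] - f s) * g s) by ring.
  apply: le_trans (ler_normD _ _) _; rewrite normrM.
  have := ler_normD (f s * (q.[s] - g s)) ((p.[s] - f s) * g s); rewrite !normrM.
  have := ler_pM (normr_ge0 _) (normr_ge0 _) pf qg.
  have := ler_pM (normr_ge0 _) (normr_ge0 _) fB qg.
  have := ler_pM (normr_ge0 _) (normr_ge0 _) pf gC.
  by move: dN; rewrite /N; lra.
rewrite pevalM; have -> : G * K - peval F p * peval F q =
    G * (K - peval F q) + ((G - peval F p) * K - (G - peval F p) * (K - peval F q)).
  by bop_ring.
apply: le_trans (opnD _ _) _.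
have := opnM G (K - peval F q).
have := opnD ((G - peval F p) * K) (- ((G - peval F p) * (K - peval F q))).
rewrite opnN; have := opnM (G - peval F p) K.
have := opnM (G - peval F p) (K - peval F q).
have := ler_pM (opn_ge0 _) (opn_ge0 _) pG qK.
have := ler_wpM2l (opn_ge0 G) qK; have := ler_wpM2r (opn_ge0 K) pG.
by move: dN; rewrite /N; lra.
Qed.

Lemma fcr_sym F f G : sym F -> fcr F f G -> sym G.
Proof.
move=> sF fG u v; apply/eqP; rewrite -subr_eq0 -normr_le0; apply/ler_addgt0Pr => e e0.
rewrite add0r; have uv0 : 0 < 2 * (hnorm u * hnorm v) + 1.
  by rewrite ltr_wpDl// !mulr_ge0 ?hnorm_ge0.
have [p _ pG] := fG _ (divr_gt0 e0 uv0).
have -> : rip (G u) v - rip u (G v) =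
    rip ((G - peval F p) u) v - rip u ((G - peval F p) v).
  by rewrite !bopE !ripE (sym_peval p sF u v); ring.
apply: le_trans (ler_normB _ _) _.
have h1 : `|rip ((G - peval F p) u) v| <= opn (G - peval F p) * (hnorm u * hnorm v).
  by apply: le_trans (rip_le_hnorm _ _) _; rewrite mulrA ler_wpM2r ?hnorm_ge0 ?opnP.
have h2 : `|rip u ((G - peval F p) v)| <= opn (G - peval F p) * (hnorm u * hnorm v).
  by apply: le_trans (rip_le_hnorm _ _) _; rewrite mulrCA ler_wpM2l ?hnorm_ge0 ?opnP.
have h3 : opn (G - peval F p) * (2 * (hnorm u * hnorm v) + 1) <= e by rewrite -ler_pdivlMr.
have := opn_ge0 (G - peval F p); lra.
Qed.

Lemma fcr_psd F f G : sym F -> fcr F f G -> (forall s, sigma F s -> 0 <= f s) -> psd G.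
Proof.
move=> sF fG f0; split=> [|u]; first exact: fcr_sym fG.
rewrite -oppr_le0; apply/ler_addgt0Pr => e e0; rewrite add0r.
have u0 : 0 < 2 * rip u u + 1 by rewrite ltr_wpDl// mulr_ge0 ?rip_ge0.
have [p pf pG] := fG _ (divr_gt0 e0 u0); set d : R := e / _ in pf pG.
have /= := (peval_psd sF (p := p + d%:P)).
case=> [s Ks|_ /(_ u)].
  by rewrite !hornerE; have := pf _ Ks; have := f0 _ Ks; rewrite ler_norml => ? /andP[]; lra.
rewrite pevalD pevalC !bopE !ripE => pu.
have := rip_opn (G - peval F p) u; rewrite !bopE !ripE ler_norml => /andP[h1 _].
have h2 := ler_wpM2r (rip_ge0 u) pG.
have h3 : d * (2 * rip u u + 1) = e by rewrite /d divfK// gt_eqF.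
have d0 : 0 < d by rewrite divr_gt0.
lra.
Qed.

Lemma hnormM u (q : quat R) : hnorm (u ** q) = Num.sqrt (qnorm2 q) * hnorm u.
Proof.
rewrite !hnormE ripMr rscaleM (_ : q * qconj q = (qnorm2 q)%:q).
  by rewrite ripZl sqrtrM// !addr_ge0 ?sqr_ge0.
by case: q => ????; congr Quat; rewrite /qnorm2 /=; ring.
Qed.

Lemma le0_of_le_inv (y C : R) : (forall n, y <= n.+1%:R^-1 * C) -> y <= 0.
Proof.
move=> yC; apply/ler_addgt0Pr => e e0; rewrite add0r.
have C1 : 0 < `|C| + 1 by rewrite ltr_wpDl.
have [N hN] := exists_inv_lt (divr_gt0 e0 C1); have := hN N (leqnn _).
rewrite ltr_pdivlMr// => /ltW; apply: le_trans; apply: le_trans (yC N) _.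
by rewrite ler_wpM2l ?invr_ge0// (le_trans (ler_norm _))// lerDl.
Qed.

(** The approximating polynomials give a Cauchy sequence at each vector. The limit inherits the rate
    [1 / (n + 1)] relative to [hnorm u], and this one estimate yields linearity, boundedness and
    convergence in operator norm. *)
Lemma fcr_exists F f : psd F -> {within sigma F, continuous f} -> exists G, fcr F f G.
Proof.
move=> pF cf; have sF := pF.1.
have /choice[p pP] (n : nat) : exists p, forall s, sigma F s -> `|p.[s] - f s| <= n.+1%:R^-1.
  apply: (weierstrass_within (M := opn F)) => //; first exact: sigma_closed.
  by move=> s Ks; rewrite (sigma_ge0 pF Ks) sigma_le_opn.
have pC m n u : hnorm (peval F (p m) u - peval F (p n) u) <=
    (m.+1%:R^-1 + n.+1%:R^-1) * hnorm u.
  rewrite -bopB; apply: le_trans (opnP _ _) _; rewrite ler_wpM2r ?hnorm_ge0//.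
  rewrite -pevalB; apply: peval_opn_le => // s Ks; rewrite !hornerE.
  have -> : (p m).[s] - (p n).[s] = ((p m).[s] - f s) - ((p n).[s] - f s) by ring.
  by apply: le_trans (ler_normB _ _) _; rewrite lerD// pP.
have /choice[g gP] u : exists l, forall e, 0 < e -> exists N, forall n, (N <= n)%N ->
    hnorm (peval F (p n) u - l) < e.
  apply: hcauchy_cvg => e e0.
  have u0 : 0 < 2 * hnorm u + 1 by rewrite ltr_wpDl// mulr_ge0 ?hnorm_ge0.
  have [N hN] := exists_inv_lt (divr_gt0 e0 u0); exists N => m n Nm Nn.
  apply: le_lt_trans (pC m n u) _.
  have h3 : e / (2 * hnorm u + 1) * (2 * hnorm u + 1) = e by rewrite divfK// gt_eqF.
  have := hN _ Nm; have := hN _ Nn; have := divr_gt0 e0 u0.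
  move: (e / _) m.+1%:R^-1 n.+1%:R^-1 h3 => d r s h3 d0 sd rd.
  have := ler_wpM2r (hnorm_ge0 u) (ltW sd); have := ler_wpM2r (hnorm_ge0 u) (ltW rd); lra.
have gN n u : hnorm (g u - peval F (p n) u) <= n.+1%:R^-1 * hnorm u.
  apply/ler_addgt0Pr => e e0.
  have u0 : 0 < hnorm u + 1 by rewrite ltr_wpDl// hnorm_ge0.
  have [N hN] := exists_inv_lt (divr_gt0 e0 u0).
  have d0 := divr_gt0 e0 u0; have [N' hN'] := gP u _ d0.
  pose m := maxn N N'; have := hN m (leq_maxl _ _); have := hN' m (leq_maxr _ _).
  rewrite hnormB => gm rd.
  have := hnormD (g u - peval F (p m) u) (peval F (p m) u - peval F (p n) u).
  rewrite addrA subrK => gn; have := pC m n u.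
  have h3 : e / (hnorm u + 1) * (hnorm u + 1) = e by rewrite divfK// gt_eqF.
  move: (e / _) m.+1%:R^-1 n.+1%:R^-1 h3 gm rd => d r s h3 gm rd.
  have := ler_wpM2r (hnorm_ge0 u) (ltW rd); lra.
have gE u v (q : quat R) : g (u ** q + v) = g u ** q + g v.
  pose N := fun n => peval F (p n).
  apply/eqP; rewrite -subr_eq0; apply/eqP/hnorm_eq0/le_anti; rewrite hnorm_ge0 andbT.
  pose C := hnorm (u ** q + v) + Num.sqrt (qnorm2 q) * hnorm u + hnorm v.
  apply: (@le0_of_le_inv _ C) => n.
  have -> : g (u ** q + v) - (g u ** q + g v) = (g (u ** q + v) - N n (u ** q + v)) -
      (((g u - N n u) ** q) + (g v - N n v)).
    by rewrite bop_lin rscaleDl rscaleN; apply: rip_inj => w; rewrite !ripE; ring.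
  have := hnormD (g (u ** q + v) - N n (u ** q + v)) (- ((g u - N n u) ** q + (g v - N n v))).
  have := hnormD ((g u - N n u) ** q) (g v - N n v).
  rewrite hnormN hnormM; have := ler_wpM2l (sqrtr_ge0 (qnorm2 q)) (gN n u).
  by have := gN n v; have := gN n (u ** q + v); rewrite /C; move: n.+1%:R^-1 => r; lra.
have hg : BH g.
  apply: (@BH_intro _ _ _ (1 + opn (peval F (p 0%N)))) => // u.
  rewrite -(subrK (peval F (p 0%N) u) (g u)) mulrDl.
  apply: le_trans (hnormD _ _) _; rewrite lerD ?opnP//.
  by have := gN 0%N u; rewrite invr1.
exists (Bop hg) => e e0; have [N hN] := exists_inv_lt e0.
exists (p N) => [s Ks|]; first by apply: le_trans (pP N s Ks) _; exact/ltW/hN.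
apply: opn_le => [|u]; first exact: ltW.
rewrite bopB /=; apply: le_trans (gN N u) _.
by rewrite ler_wpM2r ?hnorm_ge0// ltW// hN.
Qed.

End Calculus.

(* Locked, since otherwise failed unifications between values of the calculus
   unfold the functions involved, down to the definition of [powR]. *)
HB.lock Definition fc (R : realType) (H : quatHilbertType R) (F : bop H) (f : R -> R) :
  bop H := xget 0 [set G | fcr F f G].

Section ContinuousCalculus.
Variables (R : realType) (H : quatHilbertType R).
Implicit Types (u v w x : H) (a b c s t e M : R) (p q r : {poly R}) (f g : R -> R).
Implicit Types F G K Z : bop H.

Local Notation one := (1 : bop H).
Local Notation sigma := real_sigma_S.

Lemma fcP F f : psd F -> {within sigma F, continuous f} -> fcr F f (fc F f).
Proof.
move=> pF /(fcr_exists pF)[G fG]; rewrite fc.unlock.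
by case: xgetP => [K _ //|/(_ G)].
Qed.

Lemma fc_eq F f G : psd F -> fcr F f G -> fc F f = G.
Proof.
move=> pF fG; rewrite fc.unlock; case: xgetP => [K _ fK|/(_ G)//].
exact: (fcr_unique pF.1 fK fG).
Qed.

Lemma bfunB F G : (F : H -> H) - G = (F - G : bop H). Proof. by []. Qed.

Lemma is_cfc_fc F : psd F -> is_cfc F (fun f => fc F f).
Proof.
move=> pF; have sF := pF.1.
have cst1 : fcr F (fun=> 1) one.
  apply: (fcr_ext (f := horner 1%:P)) => [|s _]; last by rewrite hornerC.
  by rewrite -[X in fcr _ _ X](scale1r one) -(pevalC F); exact: fcr_poly.
split.
- split=> [f _|f g cf cg fg]; first exact: bopP.
  by congr bfun; apply: fcr_unique fg => //; exact: fcP.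
- split=> [f g cf cg|f c cf].
    by rewrite (fc_eq pF (fcr_add (fcP pF cf) (fcP pF cg))).
  by rewrite (fc_eq pF (fcr_scale c (fcP pF cf))).
- split=> [f g cf cg|].
    by rewrite (fc_eq pF (fcr_mul pF (fcP pF cf) (fcP pF cg))).
  by rewrite (fc_eq pF cst1).
- suff idF : fcr F id F by rewrite (fc_eq pF idF).
  apply: (fcr_ext (f := horner 'X)) => [|s _]; last by rewrite hornerX.
  by rewrite -[X in fcr _ _ X](pevalX F); exact: fcr_poly.
- move=> f cf e e0; exists e => // g cg fg; rewrite bfunB.
  by apply: fcr_dist (fcP pF cg) (fcP pF cf) fg; rewrite ?ltW.
Qed.

(** Whatever calculus [cfc] selects, its algebraic clauses force [peval] on polynomials, and its
    continuity clause together with density of polynomials forces the rest. [is_cfc_fc] ensures that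
    there is something to select. *)
Lemma cfcE F f : psd F -> {within sigma F, continuous f} -> cfc F f = fc F f.
Proof.
move=> pF cf; rewrite /cfc; case: xgetP => [Phi _|/(_ (fun f => fc F f)) []]; last first.
  exact: is_cfc_fc.
move=> [[PhiBH _] [PhiD PhiZ] [PhiM Phi1] PhiX PhiC].
have cp p : {within sigma F, continuous (horner p)}.
  by apply: continuous_subspaceT; exact: continuous_horner.
have cc (a : R) : {within sigma F, continuous (fun=> a)}.
  by apply: continuous_subspaceT => x; exact: cvg_cst.
have PhiP p : Phi (horner p) = peval F p.
  elim/poly_ind: p => [|p c IH].
    have := PhiZ (fun=> 1) 0 (cc 1).
    rewrite (_ : (fun s => 0 * 1) = horner 0); last by apply/funext => s; rewrite hornerC mul0r.
    move=> ->; rewrite Phi1 peval0; apply/funext => u.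
    by apply: rip_inj => w; rewrite ripZl mul0r rip0l.
  have cX : {within sigma F, continuous (@id R)}.
    by apply: continuous_subspaceT => x; exact: cvg_id.
  have cpX : {within sigma F, continuous (fun s => p.[s] * s)}.
    rewrite (_ : (fun s => _) = horner (p * 'X)); first exact: cp.
    by apply/funext => s; rewrite hornerMX.
  rewrite (_ : horner _ = (fun s => p.[s] * s + c * 1)); last first.
    by apply/funext => s; rewrite !hornerE.
  rewrite (PhiD (fun s => p.[s] * s) (fun=> c * 1))// (PhiZ (fun=> 1))//.
  rewrite (PhiM (horner p) id)// IH PhiX Phi1.
  by rewrite pevalD pevalMX pevalC.
rewrite -[Phi f]/(bfun (Bop (PhiBH f cf))); congr bfun; symmetry; apply: fc_eq => // e e0.
have [d d0 hd] := PhiC f cf e e0.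
have de0 : 0 < Num.min d e by rewrite lt_min d0.
have [p pf _] := fcP pF cf de0; exists p => [s Ks|].
  by apply: le_trans (pf s Ks) _; rewrite ge_min lexx orbT.
rewrite opnB; apply: le_trans (hd _ (cp p) _) => [|s Ks].
  by rewrite /opn PhiP.
by apply: le_trans (pf s Ks) _; rewrite ge_min lexx.
Qed.

Lemma fcPc F f : psd F -> continuous f -> fcr F f (fc F f).
Proof. by move=> pF cf; apply: fcP => //; exact: continuous_subspaceT. Qed.

Lemma fc_psd F f : psd F -> continuous f -> (forall s, 0 <= s -> 0 <= f s) -> psd (fc F f).
Proof.
by move=> pF cf f0; apply: fcr_psd (fcPc pF cf) _; [case: pF | move=> s /(sigma_ge0 pF)/f0].
Qed.

Lemma fc_le F f g : psd F -> continuous f -> continuous g ->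
  (forall s, sigma F s -> f s <= g s) -> ople (fc F f) (fc F g).
Proof.
move=> pF cf cg fg u; have fG := fcPc pF cf; have gK := fcPc pF cg.
have hD := fcr_add gK (fcr_scale (-1) fG).
have [|_ /(_ u)] := fcr_psd pF.1 hD _; first by move=> s /fg; lra.
by rewrite !bopE !ripE; lra.
Qed.

Lemma fc_dist F f g c : psd F -> continuous f -> continuous g -> 0 <= c ->
  (forall s, sigma F s -> `|f s - g s| <= c) -> opn (fc F f - fc F g) <= c.
Proof. by move=> pF cf cg c0; apply: fcr_dist => //; [case: pF | exact: fcPc..]. Qed.

Lemma sigma_itv F M s : psd F -> opn F <= M -> sigma F s -> 0 <= s <= M.
Proof.
by move=> pF FM Ks; rewrite (sigma_ge0 pF Ks) (le_trans (sigma_le_opn pF.1 Ks)).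
Qed.

(** The polynomial has no constant term, as compression by a non-invertible operator requires, and
    serves all [F] of norm at most [M], so that two operators can be compared through it. *)
Lemma fc_approx0 f M e : continuous f -> f 0 = 0 -> 0 <= M -> 0 < e ->
  exists r, forall F, psd F -> opn F <= M -> opn (fc F f - peval F (r * 'X)) <= e.
Proof.
move=> cf f0 M0 e0; have [|p hp] := @weierstrass _ f M (e / 2) cf; first by rewrite divr_gt0.
have [r rE] : exists r, p - (p.[0])%:P = r * 'X.
  have : root (p - (p.[0])%:P) 0 by rewrite rootE !hornerE subrr.
  by move=> /factor_theorem[r ->]; exists r; rewrite subr0.
exists r => F pF FM; apply: fcr_dist (fcPc pF cf) (fcr_poly F _) _; [by case: pF | exact: ltW |].
move=> s Ks; rewrite -rE !hornerE.
have := hp 0; rewrite lexx M0 f0 subr0 => /(_ isT).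
have := hp s (sigma_itv pF FM Ks); rewrite distrC.
have -> : f s - (p.[s] - p.[0]) = (f s - p.[s]) + p.[0] by ring.
by have := ler_normD (f s - p.[s]) p.[0]; lra.
Qed.

Lemma fcr_peval F f G p : psd F -> fcr F f G -> fcr F (fun s => p.[f s]) (peval G p).
Proof.
move=> pF fG; elim/poly_ind: p => [|p c IH].
  by rewrite peval0 -(peval0 F); apply: fcr_ext (fcr_poly F 0) _ => s _; rewrite !hornerC.
rewrite pevalD pevalMX pevalC -(pevalC F).
apply: fcr_ext (fcr_add (fcr_mul pF IH fG) (fcr_poly F c%:P)) _ => s _.
by rewrite !hornerE.
Qed.

Lemma fc_comp F f g : psd F -> continuous f -> continuous g ->
  (forall s, 0 <= s -> 0 <= f s) -> fc (fc F f) g = fc F (fun s => g (f s)).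
Proof.
move=> pF cf cg f0; have pG := fc_psd pF cf f0.
have cgf : continuous (fun s => g (f s)).
  by move=> s; apply: continuous_comp; [exact: cf | exact: cg].
have [B B0 hB] := continuous_bounded_itv (opn F) cf.
apply: (@eq_of_opnB _ _ _ _ 2) => e e0.
(* The interval covers both the values of [f] on the spectrum of [F] and the spectrum of [fc F f];
   no spectral mapping theorem is used. *)
have [p hp] := weierstrass (Num.max B (opn (fc F f))) cg e0.
have h1 : opn (fc (fc F f) g - peval (fc F f) p) <= e.
  apply: fcr_dist (fcPc pG cg) (fcr_poly _ p) _; [by case: pG | exact: ltW |].
  move=> s Ks; rewrite distrC; apply: hp.
  by rewrite (sigma_ge0 pG Ks) le_max (sigma_le_opn pG.1 Ks) orbT.
have h2 : opn (peval (fc F f) p - fc F (fun s => g (f s))) <= e.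
  apply: fcr_dist (fcr_peval p pF (fcPc pF cf)) (fcPc pF cgf) _; [by case: pF | exact: ltW |].
  move=> s Ks; apply: hp; have s0 := sigma_ge0 pF Ks.
  rewrite f0// le_max (le_trans (ler_norm _))// hB// s0.
  exact: sigma_le_opn pF.1 Ks.
have := opnD (fc (fc F f) g - peval (fc F f) p) (peval (fc F f) p - fc F (fun s => g (f s))).
by rewrite addrA subrK; lra.
Qed.

(* [W V Z = Z] makes [T |-> V T W] multiplicative on the polynomials in [Z]
   without constant term. *)
Lemma peval_compress V W Z r : W * V * Z = Z ->
  peval (V * Z * W) (r * 'X) = V * peval Z (r * 'X) * W.
Proof.
move=> WVZ; rewrite !pevalMX; elim/poly_ind: r => [|r c IH].
  by rewrite !peval0 !mul0r mulr0 mul0r.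
rewrite !pevalD !pevalMX !pevalC mulrDl IH.
rewrite -[V * _ * W * _]mulrA (_ : W * (V * Z * W) = Z * W); last by rewrite !mulrA WVZ.
by bop_ring.
Qed.

(** Limit of [peval_compress]. The condition [f 0 = 0] excludes constants, which would produce
    [V * W] in place of [1]. *)
Lemma fc_compress V W Z f : psd Z -> psd (V * Z * W) -> W * V * Z = Z ->
  continuous f -> f 0 = 0 -> fc (V * Z * W) f = V * fc Z f * W.
Proof.
move=> pZ pY WVZ cf f0; apply: (@eq_of_opnB _ _ _ _ (1 + opn V * opn W)) => e e0.
pose M := Num.max (opn Z) (opn (V * Z * W)).
have [|r hr] := @fc_approx0 f M e cf f0 _ e0; first by rewrite le_max opn_ge0.
have hZ := hr Z pZ; have hY := hr _ pY; rewrite !le_max !lexx ?orbT/= in hZ hY.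
rewrite (peval_compress _ WVZ) in hY.
have -> : fc (V * Z * W) f - V * fc Z f * W = (fc (V * Z * W) f - V * peval Z (r * 'X) * W)
   - (V * (fc Z f - peval Z (r * 'X)) * W) by bop_ring.
apply: le_trans (opnD _ _) _; rewrite opnN.
have h1 := opnM (V * (fc Z f - peval Z (r * 'X))) W.
have h2 := ler_wpM2r (opn_ge0 W) (opnM V (fc Z f - peval Z (r * 'X))).
have h3 : opn V * opn (fc Z f - peval Z (r * 'X)) * opn W <= opn V * e * opn W.
  by rewrite ler_wpM2r ?opn_ge0// ler_wpM2l ?opn_ge0// hZ.
by have := hY isT; lra.
Qed.

Lemma fc_fixed P Z f : psd Z -> P * Z = Z -> continuous f -> f 0 = 0 ->
  P * fc Z f = fc Z f.
Proof.
move=> pZ PZ cf f0; apply: (@eq_of_opnB _ _ _ _ (1 + opn P)) => e e0.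
have [|r hr] := @fc_approx0 f (opn Z) e cf f0 _ e0; first exact: opn_ge0.
have {}hr := hr Z pZ (lexx _).
have Pr : P * peval Z (r * 'X) = peval Z (r * 'X).
  by rewrite pevalMX peval_comm mulrA PZ.
have -> : P * fc Z f - fc Z f = P * (fc Z f - peval Z (r * 'X)) - (fc Z f - peval Z (r * 'X)).
  by rewrite -{2}Pr; bop_ring.
apply: le_trans (opnD _ _) _; rewrite opnN.
have := opnM P (fc Z f - peval Z (r * 'X)).
by have := ler_wpM2l (opn_ge0 P) hr; lra.
Qed.

End ContinuousCalculus.

(** * Powers and Hansen's inequality *)

(* With [`|s|] instead of [s], the power is continuous on the whole line; the two
   agree on the spectrum of a positive operator. *)
Definition pw (R : realType) (t : R) : R -> R := fun s => `|s| `^ t.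

HB.lock Definition pow (R : realType) (H : quatHilbertType R) (F : bop H) (t : R) :
  bop H := fc F (pw t).

Section Powers.
Variables (R : realType) (H : quatHilbertType R).
Implicit Types (u v w x : H) (a b c e l M s t : R) (f g : R -> R).
Implicit Types A B C F G K P Q V W X Y : bop H.

Local Notation one := (1 : bop H).
Local Notation sigma := real_sigma_S.

Lemma pw_cont t : 0 <= t -> continuous (pw t).
Proof. exact: continuous_normr_powR. Qed.

Lemma pw_ge0 t s : 0 <= pw t s. Proof. exact: powR_ge0. Qed.

Lemma pow_def F t : pow F t = fc F (pw t). Proof. by rewrite pow.unlock. Qed.

Lemma powP F t : psd F -> 0 <= t -> fcr F (pw t) (pow F t).
Proof. by move=> pF t0; rewrite pow_def; apply: fcPc => //; exact: pw_cont. Qed.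

Lemma pow_psd F t : psd F -> 0 <= t -> psd (pow F t).
Proof. by move=> pF t0; rewrite pow_def; apply: fc_psd => //; [exact: pw_cont | move=> s _; exact: pw_ge0]. Qed.

Lemma op_powE F t : psd F -> 0 < t -> op_pow F t = pow F t.
Proof.
move=> pF t0; have e s : sigma F s -> pw t s = s `^ t.
  by move=> /(sigma_ge0 pF) s0; rewrite /pw ger0_norm.
have cp : {within sigma F, continuous (pw t)} by apply: continuous_subspaceT; exact/pw_cont/ltW.
have cp' : {within sigma F, continuous (fun s => s `^ t)}.
  by apply: (subspace_eq_continuous (f := pw t)) => // s; rewrite inE => /e.
rewrite /op_pow cfcE//; congr bfun; apply: fc_eq => //.
by apply: fcr_ext (powP pF (ltW t0)) _.
Qed.

Lemma pow0 F : psd F -> pow F 0 = 1.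
Proof.
move=> pF; rewrite pow_def; apply: fc_eq => //; rewrite -(scale1r one) -(pevalC F).
by apply: fcr_ext (fcr_poly F _) _ => s _; rewrite hornerC /pw powRr0.
Qed.

Lemma pow1 F : psd F -> pow F 1 = F.
Proof.
move=> pF; rewrite pow_def; apply: fc_eq => //; rewrite -[X in fcr _ _ X](pevalX F).
apply: fcr_ext (fcr_poly F _) _ => s /(sigma_ge0 pF) s0.
by rewrite hornerX /pw powRr1 ger0_norm.
Qed.

Lemma powD F s t : psd F -> 0 <= s -> 0 <= t -> pow F (s + t) = pow F s * pow F t.
Proof.
move=> pF s0 t0; rewrite [LHS]pow_def; apply: fc_eq => //.
apply: fcr_ext (fcr_mul pF (powP pF s0) (powP pF t0)) _ => r _.
rewrite /pw; have [st|st] := eqVneq (s + t) 0; last by rewrite powRD// (negPf st).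
move/eqP: st; rewrite paddr_eq0// => /andP[/eqP-> /eqP->].
by rewrite addr0 powRr0 mulr1.
Qed.

Lemma powM F s t : psd F -> 0 <= s -> 0 <= t -> pow (pow F s) t = pow F (s * t).
Proof.
move=> pF s0 t0; rewrite !pow_def fc_comp//; [|exact: pw_cont..|by move=> r _; exact: pw_ge0].
by congr fc; apply/funext => r; rewrite /pw powRrM ger0_norm ?powR_ge0.
Qed.

Lemma powC F s t : psd F -> 0 <= s -> 0 <= t -> pow F s * pow F t = pow F t * pow F s.
Proof. by move=> pF s0 t0; rewrite -!powD// addrC. Qed.

Definition coercive F := exists2 c, 0 < c & forall u, c * rip u u <= rip (F u) u.

Lemma pow_coercive F t : psd F -> 0 <= t -> coercive F -> coercive (pow F t).
Proof.
move=> pF t0 [c c0 Fc]; exists (c `^ t); first exact: powR_gt0.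
rewrite pow_def; have := @fc_le _ _ F (fun=> c `^ t) (pw t) pF _ (pw_cont t0).
have -> : fc F (fun=> c `^ t) = (c `^ t) *: one.
  apply: fc_eq => //; rewrite -(pevalC F); apply: fcr_ext (fcr_poly F _) _ => s _.
  by rewrite hornerC.
move=> h u; have := h _ _ u; rewrite bopZ ripZl bop1; apply => [|s Ks].
  by move=> x; exact: cvg_cst.
by rewrite ge0_ler_powR ?nnegrE ?(ltW c0)// (le_trans (sigma_ge pF.1 Fc Ks))// ler_norm.
Qed.

Lemma psd_conj V Z : psd Z -> psd (V * Z * adj V).
Proof.
move=> [sZ Z0]; split=> [u v|u]; rewrite !bopM.
  by rewrite -(adjPr V) sZ (adjP V).
by rewrite -adjPr.
Qed.

Lemma psd_sandwich P Z : sym P -> psd Z -> psd (P * Z * P).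
Proof. by move=> sP /(psd_conj P); rewrite sym_adj. Qed.

Lemma coercive_sandwich P Z : sym P -> coercive (P * P) -> coercive Z -> coercive (P * Z * P).
Proof.
move=> sP [c c0 Pc] [d d0 Zd]; exists (d * c) => [|u]; first exact: mulr_gt0.
rewrite !bopM sP; apply: le_trans (Zd (P u)); rewrite -mulrA ler_pM2l// -sP.
exact: Pc.
Qed.

Lemma ople_trans G F K : ople F G -> ople G K -> ople F K.
Proof. by move=> FG GK u; exact: le_trans (FG u) (GK u). Qed.

Lemma ople_limit F G : (forall e, 0 < e -> ople F (G + e *: one)) -> ople F G.
Proof.
move=> FG u; apply/ler_addgt0Pr => e e0.
have u1 : 0 < rip u u + 1 by rewrite ltr_wpDl// rip_ge0.
have := FG _ (divr_gt0 e0 u1) u; rewrite !bopE ripDl ripZl.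
move/le_trans; apply; rewrite lerD2l mulrAC ler_pdivrMr// ler_pM2l//.
by rewrite lerDl.
Qed.

Lemma rip_dist F G e u : opn (F - G) <= e ->
  `|rip (F u) u - rip (G u) u| <= e * rip u u.
Proof.
move=> FG; rewrite -ripNl -ripDl -bopB; apply: le_trans (rip_opn _ _) _.
by rewrite ler_wpM2r ?rip_ge0.
Qed.

Lemma ople_opn F G e : opn (F - G) <= e -> ople F (G + e *: one).
Proof.
move=> FG u; have := ler_rip_opn (F - G) u; have := ler_wpM2r (rip_ge0 u) FG.
by rewrite !bopE !ripE; lra.
Qed.

Definition contraction V := forall u, rip (V u) (V u) <= rip u u.

Lemma contraction_adj V : contraction V -> contraction (adj V).
Proof.
move=> cV u; set w := adj V u.
have h : rip w w ^+ 2 <= rip u u * rip w w.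
  rewrite [X in X ^+ 2](adjP V u w); apply: le_trans (cauchy_schwarz _ _) _.
  by rewrite ler_wpM2l ?rip_ge0.
have [->|w0] := eqVneq (rip w w) 0; first exact: rip_ge0.
by move: h; rewrite expr2 ler_pM2r// lt_neqAle eq_sym w0 rip_ge0.
Qed.

Section Hansen.
Variables (X Y V : bop H).
Hypotheses (pX : psd X) (pY : psd Y) (cV : contraction V).
Hypothesis XY : forall v, rip (X (V v)) (V v) <= rip (Y v) v.

Let res l : R -> R := fun s => (`|s| + l)^-1.

Let res_cont l : 0 < l -> continuous (res l).
Proof.
move=> l0 s; apply: cvgV; first by rewrite gt_eqF// ltr_wpDl.
by apply: cvgD; [exact: norm_continuous | exact: cvg_cst].
Qed.

Lemma resolvent Z l u : psd Z -> 0 < l -> u = (Z + l *: one) (fc Z (res l) u).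
Proof.
move=> pZ l0; rewrite -bopM -[LHS]bop1; congr (bfun _ u).
have cZ := fcPc pZ (res_cont l0).
apply: (@fcr_unique _ _ Z (horner 1%:P) (fun s => ('X + l%:P).[s] * res l s)).
- by case: pZ.
- by rewrite -(scale1r one) -(pevalC Z); exact: fcr_poly.
- apply: fcr_mul cZ => //; rewrite -(pevalC Z) -{2}(pevalX Z) -pevalD.
  exact: fcr_poly.
- move=> s /(sigma_ge0 pZ) s0; rewrite !hornerE /res ger0_norm// mulfV//.
  by rewrite gt_eqF// ltr_wpDl.
Qed.

(* Both resolvents are expressed variationally:
   [(R z, z) >= 2 (z, w) - ((Z + l) w, w)], with equality at [w = R z]. *)
Lemma hansen_resolvent l z : 0 < l ->
  l * rip (fc Y (res l) z) z <=
  rip z z - rip (V z) (V z) + l * rip (fc X (res l) (V z)) (V z).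
Proof.
move=> l0; set v := fc Y (res l) z; set w := fc X (res l) (V z).
have zE : z = Y v + v ** l%:q by rewrite [LHS](resolvent z pY l0) !bopE.
have VzE : V z = X w + w ** l%:q by rewrite [LHS](resolvent (V z) pX l0) !bopE.
have h1 : rip v z = rip (Y v) v + l * rip v v by rewrite [in LHS]zE !ripE (ripC v).
have h2 : rip w (V z) = rip (X w) w + l * rip w w by rewrite [in LHS]VzE !ripE (ripC w).
have h3 : rip (V z) (V v) = rip (X (V v)) w + l * rip w (V v).
  by rewrite VzE !ripE (ripC _ w) pX.1 .
(* [V v] is the test vector in the variational formula for the resolvent of [X] at [V z]. *)
have h4 : 0 <= rip (X (w - V v)) (w - V v) + l * rip (w - V v) (w - V v).
  by rewrite addr_ge0 ?mulr_ge0 ?rip_ge0 ?(ltW l0)//; exact: pX.2.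
have {}h4 : 0 <= l * (rip (X w) w - 2 * rip (X (V v)) w + rip (X (V v)) (V v)
    + l * (rip w w - 2 * rip w (V v) + rip (V v) (V v))).
  rewrite mulr_ge0 ?(ltW l0)//; move: h4.
  by rewrite bopDr bopNr !ripE (ripC (V v) w) (pX.1 w (V v)) (ripC w (X (V v))); lra.
(* The contraction is applied to [z - l v], that is, to [Y v]. *)
have h5 : rip (V z) (V z) - 2 * l * rip (V z) (V v) + l ^+ 2 * rip (V v) (V v)
    <= rip z z - 2 * l * rip v z + l ^+ 2 * rip v v.
  have := cV (z - v ** l%:q).
  by rewrite bopDr bopNr bopZr !ripE (ripC z v) (ripC (V v) (V z)); lra.
have h6 : l * rip (X (V v)) (V v) <= l * rip (Y v) v by rewrite ler_wpM2l ?(ltW l0)// XY.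
by move: h5; rewrite h1 h2 h3; lra.
Qed.

Lemma hansen t : 0 <= t <= 1 -> forall v, rip (pow X t (V v)) (V v) <= rip (pow Y t v) v.
Proof.
move=> /andP[t0 t1] v; have [t00|tN0] := eqVneq t 0.
  by rewrite t00 !pow0// !bop1.
have [t10|tN1] := eqVneq t 1; first by rewrite t10 !pow1.
have t01 : 0 < t < 1 by rewrite !lt_neqAle eq_sym tN0 tN1 t0 t1.
(* A common bound, so that the same sum of resolvents approximates both powers. *)
pose M := Num.max (opn X) (opn Y).
have M0 : 0 <= M by rewrite le_max opn_ge0.
apply/ler_addgt0Pr => e e0; have v1 : 0 < 2 * rip v v + 1 by rewrite ltr_wpDl// mulr_ge0 ?rip_ge0.
have d0 := divr_gt0 e0 v1; set d : R := e / _ in d0.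
have [sq [sq0 hsq]] := powR_approx t01 M0 d0.
(* On the spectrum [s / (s + l)] equals [1 - l * res l s], the combination controlled by
   [hansen_resolvent]. *)
pose g (cls : seq (R * R)) s := \sum_(cl <- cls) cl.1 * (1 + - cl.2 * res cl.2 s).
pose gop Z (cls : seq (R * R)) := \sum_(cl <- cls) cl.1 *: (one + - cl.2 *: fc Z (res cl.2)).
have gopE Z cls : psd Z -> (forall cl, cl \in cls -> 0 <= cl.1 /\ 0 < cl.2) ->
    fcr Z (g cls) (gop Z cls).
  move=> pZ; elim: cls => [|cl cls IH] h.
    rewrite /gop big_nil -(peval0 Z); apply: fcr_ext (fcr_poly Z 0) _ => s _.
    by rewrite hornerC /g big_nil.
  have [_ l0] := h cl (mem_head _ _).
  rewrite /gop big_cons; apply: (fcr_ext (f := fun s => cl.1 * (1 + - cl.2 * res cl.2 s) + g cls s)).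
    apply: fcr_add; last by apply: IH => cl' hcl; apply: h; rewrite inE hcl orbT.
    apply: fcr_scale; apply: fcr_add; last exact/fcr_scale/fcPc/res_cont.
    rewrite -[X in fcr _ _ X]scale1r -(pevalC Z).
    by apply: fcr_ext (fcr_poly Z _) _ => s _; rewrite hornerC.
  by move=> s _; rewrite /g big_cons.
have gd Z : psd Z -> opn Z <= M -> opn (gop Z sq - pow Z t) <= d.
  move=> pZ ZM; apply: fcr_dist (gopE Z sq pZ sq0) (powP pZ t0) _.
  - by case: pZ.
  - exact: ltW.
  move=> s Ks; have sM := sigma_itv pZ ZM Ks; have s0 := sigma_ge0 pZ Ks.
  rewrite distrC /pw (ger0_norm s0); apply: le_trans (hsq s sM).
  rewrite le_eqVlt; apply/orP; left; apply/eqP; congr `|_ - _|.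
  rewrite /g big_seq [RHS]big_seq; apply: eq_bigr => cl /sq0[_ l0]; congr (_ * _).
  by rewrite /res ger0_norm//; field; rewrite gt_eqF// ltr_wpDl.
have gop_nil Z u : rip (gop Z [::] u) u = 0 by rewrite /gop big_nil; exact: rip0l.
have gop_form Z cl cls u : rip (gop Z (cl :: cls) u) u =
    cl.1 * (rip u u - cl.2 * rip (fc Z (res cl.2) u) u) + rip (gop Z cls u) u.
  rewrite /gop big_cons; move: (fc Z _) (\big[_/_]_(_ <- cls) _) => F K.
  by rewrite !bopE !ripE; ring.
have key : rip (gop X sq (V v)) (V v) <= rip (gop Y sq v) v.
  elim: sq sq0 {hsq gd} => [|cl cls IH] h; first by rewrite !gop_nil.
  have [c0 l0] := h cl (mem_head _ _).
  rewrite !gop_form lerD//; last first.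
    by apply: IH => cl' hcl; apply: h; rewrite inE hcl orbT.
  by rewrite ler_wpM2l//; have := hansen_resolvent v l0; lra.
have := rip_dist (V v) (gd X pX _); rewrite le_max lexx => /(_ isT) hX.
have := rip_dist v (gd Y pY _); rewrite le_max lexx orbT => /(_ isT) hY.
have hV : d * rip (V v) (V v) <= d * rip v v by rewrite ler_wpM2l ?(ltW d0)// cV.
have h3 : d * (2 * rip v v + 1) = e by rewrite /d divfK// gt_eqF.
clear gd gopE gop_nil gop_form; move: (gop X sq) (gop Y sq) key hX hY => gX gY key.
rewrite !ler_norml => /andP[a1 _] /andP[_ a2].
move: (rip (pow X t _) _) (rip (pow Y t _) _) a1 a2 => y1 y2 a1 a2; lra.
Qed.

End Hansen.

Lemma loewner_heinz A B t : psd A -> psd B -> ople B A -> 0 <= t <= 1 ->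
  ople (pow B t) (pow A t).
Proof. by move=> pA pB BA t01 u; apply: (@hansen B A 1). Qed.

End Powers.

(** * Furuta's inequality *)

Section Furuta.
Variables (R : realType) (H : quatHilbertType R).
Implicit Types (u v w x : H) (a c d e l s t : R).
Implicit Types A B C F G P Q V W X Y Z : bop H.


(** The exponent is the one for which [B = A] gives exactly [A^(1+t)]. *)
Definition furuta_mean A B a t :=
  pow (pow A (t / 2) * pow B a * pow A (t / 2)) ((1 + t) / (a + t)).

Lemma pow_half A t : psd A -> 0 <= t -> pow A (t / 2) * pow A (t / 2) = pow A t.
Proof.
by move=> pA t0; rewrite -powD ?divr_ge0//; congr pow; field.
Qed.

Lemma pow_half_norm A t u : psd A -> 0 <= t ->
  rip (pow A (t / 2) u) (pow A (t / 2) u) = rip (pow A t u) u.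
Proof.
move=> pA t0; have t20 : 0 <= t / 2 by rewrite divr_ge0.
by rewrite -[in RHS](pow_half pA t0) bopM [RHS](pow_psd pA t20).1.
Qed.

Lemma pow_add_half A s t u : psd A -> 0 <= s -> 0 <= t -> rip (pow A (s + t) u) u =
  rip (pow A s (pow A (t / 2) u)) (pow A (t / 2) u).
Proof.
move=> pA s0 t0; have t20 : 0 <= t / 2 by rewrite divr_ge0.
rewrite -[RHS](pow_psd pA t20).1 -!bopM -!powD ?addr_ge0//.
by congr (rip (pow _ _ _) _); field.
Qed.

Lemma furuta_exponent a t : 1 <= a -> 0 <= t -> 0 <= (1 + t) / (a + t) <= 1.
Proof.
move=> a1 t0; have at0 : 0 < a + t by rewrite ltr_wpDr// (lt_le_trans ltr01).
apply/andP; split; first by rewrite divr_ge0 ?(ltW at0)// addr_ge0.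
by rewrite ler_pdivrMr// mul1r lerD2r.
Qed.

Lemma pow_sandwich_psd A B a t : psd A -> psd B -> 0 <= a -> 0 <= t ->
  psd (pow A (t / 2) * pow B a * pow A (t / 2)).
Proof.
move=> pA pB a0 t0; apply: psd_sandwich; last exact: pow_psd.
by have [] : psd (pow A (t / 2)) by apply: pow_psd => //; rewrite divr_ge0.
Qed.

Lemma pow_sandwich_coercive A B a t : psd A -> psd B -> coercive A -> coercive B ->
  0 <= a -> 0 <= t -> coercive (pow A (t / 2) * pow B a * pow A (t / 2)).
Proof.
move=> pA pB cA cB a0 t0; apply: coercive_sandwich; last exact: pow_coercive.
  by have [] : psd (pow A (t / 2)) by apply: pow_psd => //; rewrite divr_ge0.
by rewrite pow_half//; exact: pow_coercive.
Qed.

Lemma sym_inverse P Q : sym P -> P * Q = 1 -> sym Q.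
Proof.
move=> sP PQ u v; rewrite -{2}[u]bop1 -PQ bopM sP -bopM PQ bop1 //.
Qed.

(* With [P = A^(t/2)], [Q = B^(t/2)], Loewner-Heinz makes [L = P^-1 Q] a
   contraction; apply Hansen's inequality to [L] and cancel the invertible [L]. *)
Lemma furuta_base_low A B a t : psd A -> psd B -> coercive A -> coercive B ->
  ople B A -> 1 <= a -> 0 <= t <= 1 -> ople (furuta_mean A B a t) (pow A (1 + t)).
Proof.
move=> pA pB cA cB BA a1 /andP[t0 t1]; have a0 := le_trans ler01 a1.
have t20 : 0 <= t / 2 by rewrite divr_ge0.
have pP := pow_psd pA t20; have pQ := pow_psd pB t20.
have [c c0 hc] := pow_coercive pA t20 cA; have [d d0 hd] := pow_coercive pB t20 cB.
have [P' P'P PP'] := coercive_invertible pP.1 c0 hc.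
have [Q' Q'Q QQ'] := coercive_invertible pQ.1 d0 hd.
set P := pow A (t / 2) in pP P'P PP'; set Q := pow B (t / 2) in pQ Q'Q QQ'.
have sP' := sym_inverse pP.1 PP'.
pose L := P' * Q; have PL v : P (L v) = Q v by rewrite /L -bopM mulrA PP' mul1r.
have cL : contraction L.
  rewrite -[L]adjK; apply: contraction_adj => w.
  rewrite adjM (sym_adj sP') (sym_adj pQ.1) bopM pow_half_norm//.
  have tt : 0 <= t <= 1 by rewrite t0.
  apply: le_trans (loewner_heinz pA pB BA tt (P' w)) _.
  by rewrite -pow_half_norm// -/P -bopM PP'.
move=> w; have -> : w = L (Q' (P w)) by rewrite /L bopM -(bopM Q) QQ' bop1 -bopM P'P.
move: (Q' (P w)) => v; have at0 : 0 <= a + t by rewrite addr_ge0.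
have hyp x : rip ((P * pow B a * P) (L x)) (L x) <= rip (pow B (a + t) x) x.
  by rewrite !bopM pP.1 PL pow_add_half.
have := hansen (pow_sandwich_psd pA pB a0 t0) (pow_psd pB at0) cL hyp (furuta_exponent a1 t0) v.
rewrite powM//; last by case/andP: (furuta_exponent a1 t0).
move/le_trans; apply.
have at1 : 0 < a + t by rewrite ltr_wpDr// (lt_le_trans ltr01).
(* Hansen's bound is the form of [B^(1+t)] at [v], which is that of [B] at [Q v]. Since
   [Q v = P (L v)], the form of [A] there is that of [A^(1+t)] at [L v], and [B <= A] concludes. *)
rewrite [_ * (_ / _)]mulrC divfK ?gt_eqF// !pow_add_half// !pow1//.
by rewrite PL; exact: BA.
Qed.

(* Here [L = C^(-t/2) A^(t/2)] is a contraction. *)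
Lemma furuta_base_high A C a t : psd A -> psd C -> coercive C ->
  ople A C -> 1 <= a -> 0 <= t <= 1 -> ople (pow A (1 + t)) (furuta_mean A C a t).
Proof.
move=> pA pC cC AC a1 /andP[t0 t1]; have a0 := le_trans ler01 a1.
have t20 : 0 <= t / 2 by rewrite divr_ge0.
have pP := pow_psd pA t20; have pQ := pow_psd pC t20.
have [d d0 hd] := pow_coercive pC t20 cC.
have [Q' Q'Q QQ'] := coercive_invertible pQ.1 d0 hd.
set P := pow A (t / 2) in pP; set Q := pow C (t / 2) in pQ Q'Q QQ'.
have sQ' := sym_inverse pQ.1 QQ'.
pose L := Q' * P; have QL v : Q (L v) = P v by rewrite /L -bopM mulrA QQ' mul1r.
have cL : contraction L.
  rewrite -[L]adjK; apply: contraction_adj => w.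
  rewrite adjM (sym_adj sQ') (sym_adj pP.1) bopM pow_half_norm//.
  have tt : 0 <= t <= 1 by rewrite t0.
  apply: le_trans (loewner_heinz pC pA AC tt (Q' w)) _.
  by rewrite -pow_half_norm// -/Q -bopM QQ'.
move=> v; have at0 : 0 <= a + t by rewrite addr_ge0.
have hyp x : rip (pow C (a + t) (L x)) (L x) <= rip ((P * pow C a * P) x) x.
  by rewrite pow_add_half// QL !bopM pP.1.
have := hansen (pow_psd pC at0) (pow_sandwich_psd pA pC a0 t0) cL hyp (furuta_exponent a1 t0) v.
rewrite powM//; last by case/andP: (furuta_exponent a1 t0).
apply: le_trans.
have at1 : 0 < a + t by rewrite ltr_wpDr// (lt_le_trans ltr01).
rewrite [_ * (_ / _)]mulrC divfK ?gt_eqF// !pow_add_half// !pow1//.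
by rewrite QL; exact: AC.
Qed.

(* Applying the case [t = 1] first replaces [1 + t] by [(1 + t) / 2]. *)
Lemma furuta_mean_double A B a t : psd A -> psd B -> 1 <= a -> 1 <= t ->
  furuta_mean (pow A (1 + 1)) (furuta_mean A B a 1) ((a + 1) / 2) ((t - 1) / 2) =
  furuta_mean A B a t.
Proof.
move=> pA pB a1 t1; have a0 := le_trans ler01 a1; have t0 := le_trans ler01 t1.
have pW : psd (pow A (1 / 2) * pow B a * pow A (1 / 2)) by apply: pow_sandwich_psd.
have /andP[e0 _] := furuta_exponent a1 ler01.
have s0 : 0 <= (t - 1) / 2 by rewrite divr_ge0// subr_ge0.
have at0 : 0 < a + t by rewrite ltr_wpDr// (lt_le_trans ltr01).
have a10 : 0 < a + 1 by rewrite ltr_wpDl.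
have a12 : 0 <= (a + 1) / 2 by rewrite divr_ge0// ltW.
have two0 : 0 <= 1 + 1 :> R by rewrite addr_ge0.
have s20 : 0 <= (t - 1) / 2 / 2 by rewrite divr_ge0.
rewrite /furuta_mean (powM pA two0 s20) (powM pW e0 a12).
have -> : (1 + 1) / (a + 1) * ((a + 1) / 2) = 1 by field; rewrite gt_eqF.
rewrite pow1//; congr pow.
  set r := (1 + 1) * _; have r0 : 0 <= r by rewrite mulr_ge0.
  have h0 : 0 <= 1 / 2 :> R by rewrite divr_ge0.
  have tE : r + 1 / 2 = t / 2 by rewrite /r; field.
  rewrite -tE (powD pA r0 h0) -!mulrA; congr (_ * (_ * (_ * _))).
  by rewrite powC.
by field; rewrite gt_eqF.
Qed.

(** [n] bounds the number of halvings of [1 + t]. The base case at [t = 1] says that [A^2] and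
    [furuta_mean A B a 1] are ordered as [A] and [B] are, so the induction hypothesis applies to
    them. *)
Lemma furuta_coercive n A B a t : psd A -> psd B -> coercive A -> coercive B ->
  1 <= a -> 0 <= t -> 1 + t <= 2 ^+ n ->
  (ople B A -> ople (furuta_mean A B a t) (pow A (1 + t))) /\
  (ople A B -> ople (pow A (1 + t)) (furuta_mean A B a t)).
Proof.
elim: n A B a t => [|n IH] A B a t pA pB cA cB a1 t0 tn.
  have t01 : 0 <= t <= 1 by rewrite t0; move: tn; rewrite expr0; lra.
  by split=> AB; [exact: furuta_base_low | exact: furuta_base_high].
have [t1|t1] := leP t 1.
  have t01 : 0 <= t <= 1 by rewrite t0.
  by split=> AB; [exact: furuta_base_low | exact: furuta_base_high].
have a0 := le_trans ler01 a1; have /andP[e0 _] := furuta_exponent a1 ler01.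
have pW : psd (pow A (1 / 2) * pow B a * pow A (1 / 2)) by apply: pow_sandwich_psd.
have cW : coercive (pow A (1 / 2) * pow B a * pow A (1 / 2)).
  by apply: pow_sandwich_coercive.
have pA1 : psd (pow A (1 + 1)) by apply: pow_psd => //; rewrite addr_ge0.
have cA1 : coercive (pow A (1 + 1)) by apply: pow_coercive => //; rewrite addr_ge0.
have s0 : 0 <= (t - 1) / 2 by rewrite divr_ge0// subr_ge0 ltW.
have one01 : 0 <= (1 : R) <= 1 by rewrite ler01 lexx.
have sn : 1 + (t - 1) / 2 <= 2 ^+ n by move: tn; rewrite exprS; lra.
have b1 : 1 <= (a + 1) / 2 by lra.
have [lo hi] := IH _ _ _ _ pA1 (pow_psd pW e0) cA1 (pow_coercive pW e0 cW) b1 s0 sn.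
move: lo hi; rewrite (furuta_mean_double pA pB a1 (ltW t1)) powM ?addr_ge0//.
have -> : (1 + 1) * (1 + (t - 1) / 2) = 1 + t by field.
by move=> lo hi; split=> AB; [apply: lo; exact: furuta_base_low | apply: hi; exact: furuta_base_high].
Qed.

End Furuta.

(** * Furuta's inequality without invertibility *)

Section Perturbation.
Variables (R : realType) (H : quatHilbertType R).
Implicit Types (u v w : H) (a d e l s t x : R).
Implicit Types A B F G K V W Y Z : bop H.

Local Notation one := (1 : bop H).

(** A ratio in [[0, 1]] is at most its [l]-th power; add this for [x / (x + d)] and
    [d / (x + d)]. *)
Lemma powR_subadd (x d l : R) : 0 <= x -> 0 <= d -> 0 <= l <= 1 ->
  (x + d) `^ l <= x `^ l + d `^ l.
Proof.
move=> x0 d0 /andP[l0 l1]; have [xd|xdN0] := eqVneq (x + d) 0.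
  move/eqP: xd; rewrite paddr_eq0// => /andP[/eqP-> /eqP->].
  by rewrite addr0 lerDl powR_ge0.
have z0 : 0 < x + d by rewrite lt_neqAle eq_sym xdN0 addr_ge0.
have key y : 0 <= y -> y <= x + d -> y / (x + d) * (x + d) `^ l <= y `^ l.
  move=> y0 yz; have [->|yN0] := eqVneq y 0; first by rewrite !mul0r powR_ge0.
  have u0 : 0 < y / (x + d) by rewrite divr_gt0// lt_neqAle eq_sym yN0.
  have u1 : y / (x + d) <= 1 by rewrite ler_pdivrMr// mul1r.
  rewrite -[in leRHS](divfK xdN0 y) powRM ?(ltW u0) ?(ltW z0)// ler_wpM2r ?powR_ge0//.
  by rewrite -{1}(powRr1 (ltW u0)); apply: ger_powR; rewrite ?u0.
apply: le_trans (lerD (key x x0 _) (key d d0 _)); rewrite ?lerDl ?lerDr//.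
by rewrite -mulrDl -mulrDl mulfV// mul1r.
Qed.

Lemma psd_shift A d : psd A -> 0 <= d -> psd (A + d *: one).
Proof.
move=> [sA A0] d0; split; first exact/symD/symZ/sym1.
by move=> u; rewrite bopD ripDl bopZ ripZl bop1 addr_ge0// mulr_ge0 ?rip_ge0.
Qed.

Lemma coercive_shift A d : psd A -> 0 < d -> coercive (A + d *: one).
Proof.
move=> [_ A0] d0; exists d => // u.
by rewrite bopD ripDl bopZ ripZl bop1 lerDr.
Qed.

Lemma ople_shift A B d : ople A B -> ople (A + d *: one) (B + d *: one).
Proof. by move=> AB u; rewrite !bopD !ripDl lerD2r. Qed.

(** Powers of the shifted operator become functions of [A] itself, so scalar inequalities transfer
    through a single calculus. *)
Lemma pow_shift A d s : psd A -> 0 <= d -> 0 <= s ->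
  pow (A + d *: one) s = fc A (fun x => pw s (`|x| + d)).
Proof.
move=> pA d0 s0; have cf : continuous (fun x : R => `|x| + d).
  by move=> x; apply: cvgD; [exact: norm_continuous | exact: cvg_cst].
have <- : fc A (fun x : R => `|x| + d) = A + d *: one.
  apply: fc_eq => //; rewrite -{2}(pevalX A) -(pevalC A) -pevalD.
  apply: fcr_ext (fcr_poly A _) _ => x /(sigma_ge0 pA) x0.
  by rewrite !hornerE ger0_norm.
by rewrite !pow_def fc_comp//; [exact: pw_cont | move=> x x0; rewrite addr_ge0].
Qed.

Lemma shift_cont d s : 0 <= s -> continuous (fun x : R => pw s (`|x| + d)).
Proof.
move=> s0 x; apply: (@continuous_comp R R R (fun y => `|y| + d) (pw s)); last exact: pw_cont.
by apply: cvgD; [exact: norm_continuous | exact: cvg_cst].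
Qed.

Lemma pow_shift_subadd A d l : psd A -> 0 <= d -> 0 <= l <= 1 ->
  ople (pow (A + d *: one) l) (pow A l + (d `^ l) *: one).
Proof.
move=> pA d0 l01; have l0 : 0 <= l by case/andP: l01.
have cpl : continuous (fun x => pw l x + d `^ l : R).
  by move=> x; apply: cvgD; [exact: pw_cont | exact: cvg_cst].
have -> : pow A l + (d `^ l) *: one = fc A (fun x => pw l x + d `^ l).
  symmetry; apply: fc_eq => //; rewrite -(pevalC A).
  apply: fcr_ext (fcr_add (powP pA l0) (fcr_poly A _)) _ => x _.
  by rewrite hornerC.
rewrite pow_shift//; apply: fc_le => //; first exact: shift_cont.
by move=> x _; rewrite {1}/pw ger0_norm ?addr_ge0//; exact: powR_subadd.
Qed.

Definition cvg_shift (Fd : R -> bop H) F := forall e : R, 0 < e ->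
  exists2 m : R, 0 < m & forall d, 0 < d -> d < m -> opn (Fd d - F) <= e.

Lemma cvg_shift_pow A s : psd A -> 0 <= s ->
  cvg_shift (fun d => pow (A + d *: one) s) (pow A s).
Proof.
move=> pA s0 e e0; have [m m0 hm] := heine (opn A) (@pw_cont R s s0) e0.
exists m => // d d0 dm; rewrite pow_shift ?(ltW d0)// pow_def.
apply: fc_dist => //; [exact: shift_cont | exact: pw_cont | exact: ltW |].
move=> x Kx; have x0 := sigma_ge0 pA Kx; apply: hm; first exact: sigma_itv Kx.
by rewrite (ger0_norm x0) [x + d]addrC addrK ger0_norm// ltW.
Qed.

Lemma cvg_shiftM Fd Gd F G : cvg_shift Fd F -> cvg_shift Gd G ->
  cvg_shift (fun d => Fd d * Gd d) (F * G).
Proof.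
move=> cF cG e e0; pose N : R := opn F + opn G + 1.
have N0 : 0 < N by rewrite ltr_wpDl// addr_ge0 ?opn_ge0.
pose r : R := Num.min 1 (e / N).
have r0 : 0 < r by rewrite lt_min ltr01 divr_gt0.
have r1 : r <= 1 by rewrite ge_min lexx.
have rN : r * N <= e by rewrite -ler_pdivlMr// ge_min lexx orbT.
have rr : r * r <= r by rewrite -[leRHS]mulr1 ler_wpM2l// ltW.
have [m m0 hm] := cF _ r0; have [k k0 hk] := cG _ r0.
exists (Num.min m k) => [|d d0]; first by rewrite lt_min m0.
rewrite lt_min => /andP[/(hm _ d0) dF /(hk _ d0) dG].
have -> : Fd d * Gd d - F * G =
    F * (Gd d - G) + ((Fd d - F) * G + (Fd d - F) * (Gd d - G)) by bop_ring.
have h1 := opnD (F * (Gd d - G)) ((Fd d - F) * G + (Fd d - F) * (Gd d - G)).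
have h2 := opnD ((Fd d - F) * G) ((Fd d - F) * (Gd d - G)).
have h3 := opnM F (Gd d - G); have h4 := opnM (Fd d - F) G.
have h5 := opnM (Fd d - F) (Gd d - G).
have h6 := ler_wpM2l (opn_ge0 F) dG; have h7 := ler_wpM2r (opn_ge0 G) dF.
have h8 := ler_pM (opn_ge0 _) (opn_ge0 _) dF dG.
by move: rN; rewrite /N; lra.
Qed.

(** Order form of Hoelder continuity: [F <= G + d], then Loewner-Heinz, then subadditivity of the
    power. *)
Lemma pow_ople_approx F G l d : psd F -> psd G -> 0 <= l <= 1 -> 0 <= d ->
  opn (F - G) <= d -> ople (pow F l) (pow G l + (d `^ l) *: one).
Proof.
move=> pF pG l01 d0 FG; apply: ople_trans (pow_shift_subadd pG d0 l01).
by apply: loewner_heinz => //; [exact: psd_shift | exact: ople_opn].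
Qed.

Lemma furuta A B a t : psd A -> psd B -> 1 <= a -> 0 <= t ->
  (ople B A -> ople (furuta_mean A B a t) (pow A (1 + t))) /\
  (ople A B -> ople (pow A (1 + t)) (furuta_mean A B a t)).
Proof.
move=> pA pB a1 t0; have a0 := le_trans ler01 a1.
have t10 : 0 <= 1 + t by rewrite addr_ge0.
have t20 : 0 <= t / 2 by rewrite divr_ge0.
have l01 := furuta_exponent a1 t0; rewrite /furuta_mean.
have lgt0 : 0 < (1 + t) / (a + t).
  by rewrite divr_gt0// ltr_wpDr// (lt_le_trans ltr01).
set l := _ / (a + t) in l01 lgt0 *; set W := _ * _ * _.
have pW : psd W by exact: pow_sandwich_psd.
have [n tn] : exists n, 1 + t <= 2 ^+ n.
  have tp : 0 < (1 + t)^-1 by rewrite invr_gt0 ltr_wpDr.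
  have half0 : 0 <= 2^-1 :> R by [].
  have half1 : 2^-1 < 1 :> R by rewrite invf_lt1// ltr1n.
  have [n hn] := expr_small half0 half1 tp.
  by exists n; move: hn; rewrite exprVn ltf_pV2 ?posrE ?exprn_gt0 ?ltr_wpDr// => /ltW.
pose Ad d := A + d *: one; pose Bd d := B + d *: one.
pose Wd d := pow (Ad d) (t / 2) * pow (Bd d) a * pow (Ad d) (t / 2).
have cW : cvg_shift Wd W.
  by apply: cvg_shiftM; [apply: cvg_shiftM|]; exact: cvg_shift_pow.
have approx e : 0 < e -> exists d, [/\ 0 < d, opn (pow (Ad d) (1 + t) - pow A (1 + t)) <= e,
    ople (pow W l) (pow (Wd d) l + e *: one) & ople (pow (Wd d) l) (pow W l + e *: one)].
  move=> e0; pose r := e `^ l^-1.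
  have r0 : 0 < r by exact: powR_gt0.
  have rl : r `^ l = e by rewrite -powRrM mulVf ?gt_eqF// powRr1// ltW.
  have [m m0 hm] := cW r r0; have [k k0 hk] := cvg_shift_pow pA t10 e0.
  pose d := Num.min m k / 2.
  have d0 : 0 < d by rewrite divr_gt0// lt_min m0.
  have dmk : d < Num.min m k by rewrite ltr_pdivrMr// ltr_pMr ?ltr1n// lt_min m0.
  move: (dmk); rewrite lt_min => /andP[dm dk].
  have pWd : psd (Wd d) by apply: pow_sandwich_psd => //; apply: psd_shift => //; exact: ltW.
  exists d; split => //; first exact: hk.
    by rewrite -rl; apply: pow_ople_approx => //; rewrite ?(ltW r0)// opnB hm.
  by rewrite -rl; apply: pow_ople_approx => //; rewrite ?(ltW r0)// hm.
have shifted d : 0 < d -> (ople B A -> ople (pow (Wd d) l) (pow (Ad d) (1 + t))) /\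
    (ople A B -> ople (pow (Ad d) (1 + t)) (pow (Wd d) l)).
  move=> d0; have [lo hi] := furuta_coercive (psd_shift pA (ltW d0)) (psd_shift pB (ltW d0))
    (coercive_shift pA d0) (coercive_shift pB d0) a1 t0 tn.
  by split=> AB; [apply: lo | apply: hi]; exact: ople_shift.
split=> AB; apply: ople_limit => e e0; have e2 : 0 < e / 2 by rewrite divr_gt0.
- have [d [d0 dA dW _]] := approx _ e2; have [lo _] := shifted d d0.
  move=> u; have := dW u; have := lo AB u; have := rip_dist u dA.
  rewrite !bopD !ripDl !bopZ !ripZl bop1 ler_norml => /andP[_]; lra.
- have [d [d0 dA _ dW]] := approx _ e2; have [_ hi] := shifted d d0.
  move=> u; have := dW u; have := hi AB u; have := rip_dist u dA.
  rewrite !bopD !ripDl !bopZ !ripZl bop1 ler_norml => /andP[+ _]; lra.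
Qed.

End Perturbation.

(** * The polar factor and the Aluthge transform *)

Section PolarDecomposition.
Variables (R : realType) (H : quatHilbertType R).
Implicit Types (u v w x k : H) (p s t : R).
Implicit Types F G U V X Z : bop H.

Local Notation one := (1 : bop H).

(** [op_le] also asks for vanishing imaginary parts; symmetry makes [inner (F u) u] equal to its
    conjugate. *)
Lemma op_leP F G : sym F -> sym G -> op_le F G <-> ople F G.
Proof.
move=> sF sG; have sGF : sym (G - F) by exact/symD/symN.
have GFE x : ((G : H -> H) - F) x = (G - F : bop H) x by [].
split=> [FG u|FG u].
  have [_ _ _] := FG u; rewrite GFE -rip_def.
  by rewrite bopB ripDl ripNl subr_ge0.
have real : qconj (inner ((G - F : bop H) u) u) = inner ((G - F : bop H) u) u.
  by rewrite innerC; apply: rip_inner => q; rewrite -bopZr sGF.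
rewrite GFE /qge0; have := FG u; rewrite -subr_ge0 -ripNl -ripDl -bopB rip_def.
move: (inner _ _) real => -[a b c d] [? ? ?] /= a0.
by split=> //; lra.
Qed.

Lemma psd1 : psd one.
Proof. by split=> // u; rewrite bop1 rip_ge0. Qed.

Lemma psd_mul_adj V : psd (V * adj V).
Proof. by have := psd_conj V psd1; rewrite mulr1. Qed.

Lemma psd_adj_mul V : psd (adj V * V).
Proof. by have := psd_mul_adj (adj V); rewrite adjK. Qed.

Lemma rsubspace_ker X : rsubspace (op_ker X).
Proof.
split=> [|u v|u a|x l xK xl]; rewrite /op_ker /= ?bop0r//.
- by move=> Xu Xv; rewrite bopDr Xu Xv addr0.
- by move=> Xu; rewrite bopZr Xu rscale0.
apply: hnorm_eq0; apply: le_anti; rewrite hnorm_ge0 andbT.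
apply/ler_addgt0Pr => e e0; rewrite add0r.
have X1 : 0 < opn X + 1 by rewrite ltr_wpDl ?opn_ge0.
have [N hN] := xl _ (divr_gt0 e0 X1); have := hN N (leqnn _).
rewrite ltr_pdivlMr// => h; have -> : X l = X (l - x N).
  by rewrite bopDr bopNr xK subr0.
apply: le_trans (opnP _ _) _; rewrite hnormB; apply: le_trans (ltW h).
by rewrite mulrC ler_wpM2l ?hnorm_ge0// lerDl.
Qed.

(** The kernel is stable under right multiplication by quaternions, so real orthogonality to it is
    full orthogonality. *)
Lemma orthogonal_kerP X u : (forall v, op_ker X v -> rip u v = 0) ->
  orthogonal_to (op_ker X) u.
Proof.
move=> ou v Xv; have -> : inner u v = inner u 0.
  apply: rip_inner => q; rewrite rscale0 ripr0; apply: ou.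
  by rewrite /op_ker /= bopZr Xv rscale0.
by rewrite -(rscale0 H 0) innerZr mulr0.
Qed.

Lemma ker_decomposition X w : exists2 k, op_ker X k &
  orthogonal_to (op_ker X) (w - k) /\ (forall v, op_ker X v -> rip (w - k) v = 0).
Proof.
have [k Xk hk] := projection w (rsubspace_ker X); exists k => //.
by split=> //; exact: orthogonal_kerP.
Qed.

Section PartialIsometry.
Variables U X : bop H.
Hypothesis sX : sym X.
Hypothesis isoU : forall u, orthogonal_to (op_ker X) u -> hnorm (U u) = hnorm u.
Hypothesis kerU : forall u, op_ker X u -> U u = 0.

Lemma polar_contraction : contraction U.
Proof.
move=> w; have [k Xk [ok rk]] := ker_decomposition X w.
have -> : U w = U (w - k) by rewrite bopDr bopNr (kerU Xk) subr0.
rewrite -sqr_hnorm isoU// sqr_hnorm.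
have := rk k Xk; have := rip_ge0 k; rewrite !ripE (ripC k w); lra.
Qed.

(** Polarisation: [U] preserves the norms of [X v], of [w - k] and of their sum, all orthogonal to
    the kernel, hence the product of the first two. *)
Lemma polar_adj_mul : adj U * U * X = X.
Proof.
apply: bop_eq => v; apply: rip_inj => w; rewrite !bopM adjP.
have [k Xk [ok rk]] := ker_decomposition X w.
have -> : U w = U (w - k) by rewrite bopDr bopNr (kerU Xk) subr0.
have oX : orthogonal_to (op_ker X) (X v).
  by apply: orthogonal_kerP => u Xu; rewrite sX Xu ripr0.
have oD : orthogonal_to (op_ker X) (X v + (w - k)).
  apply: orthogonal_kerP => u Xu; rewrite ripDl rk// addr0.
  by rewrite sX Xu ripr0.
have Xvk : rip (X v) k = 0 by rewrite sX Xk ripr0.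
have := congr1 (fun y => y ^+ 2) (isoU oD); have := congr1 (fun y => y ^+ 2) (isoU oX).
have := congr1 (fun y => y ^+ 2) (isoU ok); rewrite !sqr_hnorm.
rewrite (bopDr U (X v)); move: (U (X v)) (U (w - k)) => y z yy zz.
rewrite !(ripDl, ripDr y, ripDr z) (ripC z y) !ripE (ripC w (X v)) (ripC k (X v)) Xvk.
by move: yy zz; rewrite !ripE; lra.
Qed.

End PartialIsometry.
End PolarDecomposition.

Theorem theorem12 (R : realType) (H : quatHilbertType R) (p : R) (T U : H -> H)
    (hp : 0 < p < 2^-1) (hT : BH T) (hyp : hyponormal p T)
    (hU : polar_decomposition T U) :
  hyponormal (p + 2^-1) (aluthge T U).
Proof.
case: hU => hBU; case/andP: hp => p0 p2.
rewrite -[T]/(bfun (Bop hT)) in hyp *; rewrite -[U]/(bfun (Bop hBU)).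
move: (Bop hT) (Bop hBU) hyp => {hT hBU T U} T U.
have pTT := psd_adj_mul T; have pTT' := psd_mul_adj T.
have half0 : 0 < 2^-1 :> R by rewrite invr_gt0.
have absE : op_abs T = pow (adj T * T) 2^-1.
  by rewrite /op_abs adjointE -op_powE.
rewrite /hyponormal /aluthge absE; set X := pow (adj T * T) 2^-1.
have pX : psd X by apply: pow_psd => //; exact: ltW.
move=> hyp TE isoU kerU.
have cU : contraction U := polar_contraction isoU kerU.
have UUX : adj U * U * X = X := polar_adj_mul pX.1 isoU kerU.
have XX : X * X = adj T * T.
  by rewrite /X -powD ?(ltW half0)// -[RHS]pow1//; congr pow; field.
have {}TE : T = U * X by apply: bop_eq => u; rewrite {1}TE.
have TT' : T * adj T = U * (X * X) * adj U.
  by rewrite TE adjM (sym_adj pX.1) !mulrA.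
pose h : R := 2 * p; have h0 : 0 < h by rewrite mulr_gt0.
have h1 : h < 1 by rewrite /h; lra.
have h01 : 0 <= h <= 1 by rewrite !ltW.
have pw0 s : 0 < s -> pw s 0 = 0 :> R by move=> s0; rewrite /pw normr0 powR0// gt_eqF.
have pTp : pow (adj T * T) p = pow X h.
  by rewrite /X powM ?ltW//; congr pow; rewrite /h; field.
set Y := U * X * adj U; have pY : psd Y by exact: psd_conj.
pose Q := adj U * X * U.
have pQ : psd Q by have := psd_conj (adj U) pX; rewrite adjK.
(* Compression by [U] commutes with the power because [adj U * U] fixes [X]; the same argument with
   [X * X] handles [T * adj T] below. *)
have Yh : pow Y h = U * pow X h * adj U.
  by rewrite !(pow_def _ h); apply: fc_compress => //; [exact/pw_cont/ltW | exact: pw0].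
have Tp : pow (T * adj T) p = pow Y h.
  rewrite Yh -pTp TT' -XX !(pow_def _ p); apply: fc_compress => //.
  - by rewrite XX.
  - by rewrite -TT'.
  - by rewrite !mulrA -(mulrA (adj U)) mulrA UUX.
  - exact/pw_cont/ltW.
  - exact: pw0.
have BA : ople (pow Y h) (pow X h).
  rewrite -Tp -pTp; apply/op_leP; [exact: (pow_psd pTT' (ltW p0)).1|exact: (pow_psd pTT (ltW p0)).1|].
  by rewrite -!op_powE//; rewrite adjointE in hyp; exact: hyp.
have sXh := (pow_psd pX (ltW h0)).1.
have UUXh : adj U * U * pow X h = pow X h.
  by rewrite pow_def; apply: fc_fixed => //; [exact/pw_cont/ltW | exact: pw0].
(* [BA] at [U v] has the form of [pow X h] at [v] on its left, as [adj U * U] fixes [pow X h] on the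
   left and, by symmetry, on the right. *)
have AC : ople (pow X h) (pow Q h).
  move=> v; have hQ := @hansen _ _ X Q U pX pQ cU _ h h01 v.
  apply: le_trans (hQ _); last by move=> w; rewrite !bopM adjP.
  apply: le_trans (BA (U v)); rewrite Yh !bopM.
  have Nh u : adj U (U (pow X h u)) = pow X h u by rewrite -!bopM UUXh.
  by rewrite -(adjP U) Nh [leRHS]sXh (adjP U) -(adjPr U) Nh -sXh.
pose a : R := h^-1; have a1 : 1 <= a by rewrite invf_ge1// ltW.
have a0 : 0 <= a := le_trans ler01 a1.
have ha : h * a = 1 by rewrite mulfV// gt_eqF.
set S := pow X 2^-1; have pS : psd S by apply: pow_psd => //; exact: ltW.
have SS : S * S = X by rewrite /S -powD ?(ltW half0)// -[RHS]pow1//; congr pow; field.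
(* Taking [t = a] turns the outer factors into [S], while the [a]-th powers of [pow Y h] and
   [pow Q h] return [Y] and [Q]; the two sandwiches are [L * adj L] and [adj L * L]. *)
have Aa : pow (pow X h) (a / 2) = S.
  by rewrite powM ?(ltW h0) ?divr_ge0// mulrA ha mul1r.
have lE : (1 + a) / (a + a) = p + 2^-1 by rewrite /a /h; field; rewrite gt_eqF.
have pXh := pow_psd pX (ltW h0).
have [+ _] := furuta pXh (pow_psd pY (ltW h0)) a1 a0.
have [_ +] := furuta pXh (pow_psd pQ (ltW h0)) a1 a0.
rewrite /furuta_mean Aa (powM pY (ltW h0) a0) (powM pQ (ltW h0) a0) ha !pow1// lE.
move=> /(_ AC) hi /(_ BA) lo.
pose L := S * U * S; have adjL : adj L = S * adj U * S by rewrite !adjM (sym_adj pS.1) mulrA.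
have LL : L * adj L = S * Y * S by rewrite adjL /L /Y -SS !mulrA.
have LL' : adj L * L = S * Q * S by rewrite adjL /L /Q -SS !mulrA.
have q0 : 0 < p + 2^-1 by rewrite addr_gt0.
rewrite op_powE// -/S -[S \o U \o S]/(bfun L) adjointE.
rewrite -[L \o adj L]/(bfun (L * adj L)) -[adj L \o L]/(bfun (adj L * L)).
have pL := psd_mul_adj L; have pL' := psd_adj_mul L.
rewrite !op_powE//; apply/op_leP; [exact: (pow_psd pL (ltW q0)).1|exact: (pow_psd pL' (ltW q0)).1|].
by rewrite LL LL'; exact: ople_trans lo hi.
Qed.
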